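(* Let $n\ge 2$. Then there exists a vector bundle $\mathcal{V}$ of rank $n$ on $\mathbb{P}_n\times\Delta$ such that $\mathcal{V}_t\simeq T_{\mathbb{P}_n}$ for $t\ne 0$ and $h^0(\mathcal{V}_0(-2))=1$; so in particular $\mathcal{V}_0\not\simeq T_{\mathbb{P}_n}$.
   Context: $\Delta\subset\mathbb{C}$ is a one-dimensional disc centred at $0$; vector bundles are holomorphic. For $t\in\Delta$, $\mathcal{V}_t:=\mathcal{V}|_{\mathbb{P}_n\times\{t\}}$, regarded as a bundle on $\mathbb{P}_n$. For a bundle $V$ on $\mathbb{P}_n$, $V(k)=V\otimes\mathcal{O}_{\mathbb{P}_n}(k)$, and $h^0=\dim H^0$. *)

(* Defs.v *)
From HB Require Import structures.
From mathcomp Require Import all_boot all_order all_algebra.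
From mathcomp Require Import all_classical all_reals all_analysis.
From mathcomp Require Import complex mxtens.

Set Implicit Arguments.
Unset Strict Implicit.
Unset Printing Implicit Defensive.

Import Order.TTheory GRing.Theory Num.Theory.
Import numFieldNormedType.Exports.

Local Open Scope classical_set_scope.
Local Open Scope ring_scope.
Local Open Scope complex_scope.

HB.instance Definition _ (R : realType) := NormedModule.copy R[i] R[i]^o.

Fact openX (S T : topologicalType) (A : set S) (B : set T) :
  open A -> open B -> open (A `*` B).
Proof.
move=> oA oB; rewrite openE => -[x y] [/= Ax By].
by exists (A, B) => //; split; exact: open_nbhs_nbhs.
Qed.

Fact near_eq_differentiable (K : numFieldType) (V W : normedModType K)
    (f g : V -> W) (x : V) :
  (\forall y \near x, f y = g y) -> differentiable f x -> differentiable g x.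
Proof.
move=> fg [[dfc dfE]]; pose F := nbhs_filter_on x.
have fgx : f (lim F) = g (lim F) by rewrite lim_id //; exact: nbhs_singleton fg.
suff /getPex Pd : exists d : {linear V -> W}, continuous d /\ forall y,
    g y = g (lim F) + d (y - lim F) +o_(y \near F) (y - lim F).
  by apply/(@diffP _ _ _ F).
exists ('d f x); split=> //.
suff : g = cst (g (lim F)) + 'd f F \o center (lim F) +o_F (center (lim F)).
  by rewrite {1}funeqE.
apply/eqaddoP => e e0; move/eqaddoP/(_ e e0): dfE.
by apply: filterS2 fg => y fgy; rewrite -fgx /= !fctE fgy.
Qed.

(** * Complex manifolds *)

(* A holomorphic atlas modelled on [E], presented by parametrizations
   [par a : dom a -> X] (inverse charts) and charts [chart_map a].  Both are
   total functions, whose values outside [dom a] and [par a @` dom a] are junk.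
   "Holomorphic" is Frechet differentiability over the field [R[i]].  Separation
   and countability are not part of the structure. *)
Record atlas (R : realType) (E : normedModType R[i]) := Atlas {
  point :> Type;
  chart : Type;
  dom : chart -> set E;
  par : chart -> E -> point;
  chart_map : chart -> point -> E;
  open_dom : forall a, open (dom a);
  parK : forall a z, dom a z -> chart_map a (par a z) = z;
  par_cover : forall x, exists a, exists2 z, dom a z & par a z = x;
  open_overlap : forall a b, open (dom a `&` par a @^-1` (par b @` dom b));
  holo_transition : forall a b z, dom a z -> (par b @` dom b) (par a z) ->
    differentiable (chart_map b \o par a) z }.

Arguments dom {R E} X a : rename.
Arguments par {R E} X a z : rename.
Arguments chart_map {R E} X a x : rename.

Section Holomorphy.
Variables (R : realType) (E : normedModType R[i]) (X : atlas E).

Definition open_on (W : set X) :=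
  forall a, open (dom X a `&` par X a @^-1` W).

(* [W] is meant to be open, so that [f] off [W] is irrelevant. *)
Definition holomorphic_on (F : normedModType R[i]) (W : set X) (f : X -> F) :=
  forall a z, dom X a z -> W (par X a z) -> differentiable (f \o par X a) z.

End Holomorphy.

Section Product.
Variables (R : realType) (E F : normedModType R[i]).
Variables (X : atlas E) (Y : atlas F).

Let pdom (c : chart X * chart Y) : set (E * F) := dom X c.1 `*` dom Y c.2.
Let ppar (c : chart X * chart Y) (z : E * F) := (par X c.1 z.1, par Y c.2 z.2).
Let pcoord (c : chart X * chart Y) (x : X * Y) : E * F :=
  (chart_map X c.1 x.1, chart_map Y c.2 x.2).

Let pimage c z : pdom c z -> forall c', (ppar c' @` pdom c') (ppar c z) <->
  (par X c'.1 @` dom X c'.1) (par X c.1 z.1) /\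
  (par Y c'.2 @` dom Y c'.2) (par Y c.2 z.2).
Proof.
move=> _ c'; split=> [[[u v] [/= du dv] [<- <-]]|[[u du eu] [v dv ev]]].
  by split; [exists u | exists v].
by exists (u, v); rewrite /ppar /= ?eu ?ev.
Qed.

Fact prod_open_dom c : open (pdom c).
Proof. by apply: openX; exact: open_dom. Qed.

Fact prod_parK c z : pdom c z -> pcoord c (ppar c z) = z.
Proof. by case: z => u v [/= du dv]; rewrite /pcoord /= !parK. Qed.

Fact prod_cover x : exists c, exists2 z, pdom c z & ppar c z = x.
Proof.
case: x => x y; have [a [u du <-]] := par_cover x.
by have [b [v dv <-]] := par_cover y; exists (a, b), (u, v).
Qed.

Fact prod_open_overlap c c' :
  open (pdom c `&` ppar c @^-1` (ppar c' @` pdom c')).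
Proof.
rewrite (_ : _ `&` _ =
  (dom X c.1 `&` par X c.1 @^-1` (par X c'.1 @` dom X c'.1)) `*`
  (dom Y c.2 `&` par Y c.2 @^-1` (par Y c'.2 @` dom Y c'.2))).
  by apply: openX; exact: open_overlap.
apply/seteqP; split=> z /=.
  by move=> [dz] /(pimage dz)[iu iv]; case: dz => du dv.
by move=> [[du iu] [dv iv]]; split=> //; apply/(@pimage c z).
Qed.

Fact prod_holo_transition c c' z : pdom c z ->
  (ppar c' @` pdom c') (ppar c z) -> differentiable (pcoord c' \o ppar c) z.
Proof.
move=> dz /(pimage dz)[iu iv]; case: dz => du dv.
have dfst : differentiable (fst : E * F -> E) z.
  by apply: (@linear_differentiable _ _ _ fst) => z'; exact: cvg_fst.
have dsnd : differentiable (snd : E * F -> F) z.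
  by apply: (@linear_differentiable _ _ _ snd) => z'; exact: cvg_snd.
have dX := differentiable_comp dfst (holo_transition du iu).
have dY := differentiable_comp dsnd (holo_transition dv iv).
exact: differentiable_pair dX dY.
Qed.

Definition prod_atlas : atlas (E * F)%type :=
  Atlas prod_open_dom prod_parK prod_cover prod_open_overlap
    prod_holo_transition.

End Product.

Section Disc.
Variables (R : realType) (rho : {posnum R}).

Definition disc := {t : R[i] | `|t| < (rho%:num)%:C}.

Fact disc0_subproof : `|0 : R[i]| < (rho%:num)%:C.
Proof. by rewrite normr0 ltcR. Qed.

Definition disc0 : disc := Sub 0 disc0_subproof.

Let ddom (_ : unit) : set R[i] := [set z | `|z| < (rho%:num)%:C].
Let dpar (_ : unit) (z : R[i]) : disc := insubd disc0 z.
Let dcoord (_ : unit) (t : disc) : R[i] := val t.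

Fact disc_open_dom a : open (ddom a).
Proof.
rewrite (_ : ddom a = ball (0 : R[i]) (rho%:num)%:C).
  by apply: ball_open; rewrite ltcR.
by apply/seteqP; split=> z; rewrite -ball_normE /ddom /ball_ /= sub0r normrN.
Qed.

Fact disc_parK a z : ddom a z -> dcoord a (dpar a z) = z.
Proof. by move=> dz; rewrite /dcoord insubdK. Qed.

Fact disc_cover t : exists a, exists2 z, ddom a z & dpar a z = t.
Proof. by exists tt, (val t); [exact: (valP t) | exact: valKd]. Qed.

Fact disc_open_overlap a b :
  open (ddom a `&` dpar a @^-1` (dpar b @` ddom b)).
Proof.
rewrite (_ : _ `&` _ = ddom a); first exact: disc_open_dom.
by apply/seteqP; split=> z /= => [[]|dz] //; split=> //; exists z.
Qed.

Fact disc_holo_transition a b z : ddom a z ->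
  (dpar b @` ddom b) (dpar a z) -> differentiable (dcoord b \o dpar a) z.
Proof.
move=> dz _; apply: (@near_eq_differentiable _ _ _ id) => //.
have := open_nbhs_nbhs (conj (@disc_open_dom a) dz).
by apply: filterS => y dy /=; apply/esym/(@disc_parK b).
Qed.

Definition disc_atlas : atlas R[i] :=
  Atlas disc_open_dom disc_parK disc_cover disc_open_overlap
    disc_holo_transition.

End Disc.

Section ProjectiveSpace.
Variables (R : realType) (n : nat).

(* Lines through 0. *)
Definition pspace := {L : {vspace 'rV[R[i]]_n.+1} | \dim L == 1%N}.

(* [z] completed by a 1 in position [i]. *)
Definition affine_lift (i : 'I_n.+1) (z : 'rV[R[i]]_n) : 'rV[R[i]]_n.+1 :=
  \row_j oapp (z 0) 1 (unlift i j).

Lemma affine_lift_neq0 i z : affine_lift i z != 0.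
Proof.
apply/negP => /eqP/rowP/(_ i); rewrite !mxE unlift_none /= => /eqP.
by rewrite oner_eq0.
Qed.

Fact dim_affine_lift i z : \dim <[affine_lift i z]>%VS == 1%N.
Proof. by rewrite dim_vline affine_lift_neq0. Qed.

Let pdom (_ : 'I_n.+1) : set 'rV[R[i]]_n := setT.

(* z |-> [z_0 : ... : 1 : ... : z_(n-1)]. *)
Let ppar (i : 'I_n.+1) (z : 'rV[R[i]]_n) : pspace :=
  exist _ <[affine_lift i z]>%VS (dim_affine_lift i z).

(* Homogeneous coordinates of [L]; the choice of generator only matters up to
   a scalar. *)
Definition hcoord (L : pspace) : 'rV[R[i]]_n.+1 := vpick (val L).

Let pcoord (i : 'I_n.+1) (L : pspace) : 'rV[R[i]]_n :=
  \row_k (hcoord L 0 (lift i k) / hcoord L 0 i).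

Lemma hcoord_neq0 L : hcoord L != 0.
Proof.
rewrite vpick0; case: L => L /= dL; apply/negP => /eqP L0.
by rewrite L0 dimv0 in dL.
Qed.

Lemma hcoord_affine_lift i z :
  exists2 c, c != 0 & hcoord (ppar i z) = c *: affine_lift i z.
Proof.
have := memv_pick (val (ppar i z)) => /vlineP[c cE]; exists c => //.
apply/negP => /eqP c0; have := hcoord_neq0 (ppar i z).
by rewrite /hcoord cE c0 scale0r eqxx.
Qed.

Lemma pimage i L : (ppar i @` pdom i) L <-> hcoord L 0 i != 0.
Proof.
split=> [[z _ <-]|Li].
  by have [c c0 ->] := hcoord_affine_lift i z; rewrite !mxE unlift_none mulr1.
exists (pcoord i L) => //; apply/val_inj => /=.
have -> : affine_lift i (pcoord i L) = (hcoord L 0 i)^-1 *: hcoord L.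
  apply/rowP => j; rewrite !mxE; case: unliftP => [k ->|->] /=.
    by rewrite mxE mulrC.
  by rewrite mulVf.
apply/eqP; rewrite eqEdim dim_vline scaler_eq0 invr_eq0 (negPf Li).
rewrite (negPf (hcoord_neq0 L)) /= (eqP (valP L)) leqnn andbT.
by rewrite -memvE memvZ// memv_pick.
Qed.

Fact pspace_open_dom i : open (pdom i).
Proof. exact: openT. Qed.

Fact pspace_parK i z : pdom i z -> pcoord i (ppar i z) = z.
Proof.
move=> _; apply/rowP => k; rewrite mxE.
have [c c0 ->] := hcoord_affine_lift i z.
by rewrite !mxE liftK unlift_none /= mulr1 mulrAC divff// mul1r.
Qed.

Fact pspace_cover L : exists i, exists2 z, pdom i z & ppar i z = L.
Proof.
have [i Li] : exists i, hcoord L 0 i != 0 by apply/rV0Pn/hcoord_neq0.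
by exists i; have [] := (pimage i L).2 Li => z; exists z.
Qed.

Lemma pimage_ppar i j z :
  (ppar j @` pdom j) (ppar i z) <-> affine_lift i z 0 j != 0.
Proof.
rewrite pimage; have [c c0 ->] := hcoord_affine_lift i z.
by rewrite mxE mulf_eq0 negb_or c0.
Qed.

Lemma differentiable_affine_lift i j z :
  differentiable (fun z => affine_lift i z 0 j) z.
Proof.
rewrite (_ : (fun z => _) =
    fun z : 'rV[R[i]]_n => oapp (z 0) 1 (unlift i j) : R[i]); last first.
  by apply/funext => w; rewrite mxE.
case: (unlift i j) => [k|] /=; last exact: differentiable_cst.
exact: differentiable_coord.
Qed.

Fact pspace_open_overlap i j :
  open (pdom i `&` ppar i @^-1` (ppar j @` pdom j)).
Proof.
rewrite (_ : _ `&` _ = (fun z => affine_lift i z 0 j) @^-1` [set~ 0]).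
  apply: open_comp; last first.
    apply/closed_openC/accessible_closed_set1/hausdorff_accessible.
    exact: norm_hausdorff.
  move=> z _; apply: differentiable_continuous.
  exact: differentiable_affine_lift.
apply/seteqP; split=> z /=.
  by move=> [_ /pimage_ppar/eqP].
by move=> /eqP zj; split=> //; apply/pimage_ppar.
Qed.

Fact pspace_holo_transition i j z : pdom i z ->
  (ppar j @` pdom j) (ppar i z) -> differentiable (pcoord j \o ppar i) z.
Proof.
move=> _ /pimage_ppar zj.
rewrite (_ : _ \o _ = \sum_(k < n) (fun w =>
   (affine_lift i w 0 (lift j k) / affine_lift i w 0 j) *: delta_mx 0 k)).
  apply: differentiable_sum => k; apply: differentiableZl.
  apply: differentiableM; first exact: differentiable_affine_lift.
  apply: differentiableV => //; exact: differentiable_affine_lift.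
apply/funext => w; rewrite fct_sumE /= [LHS]row_sum_delta.
apply: eq_bigr => k _; rewrite mxE; have [c c0 ->] := hcoord_affine_lift i w.
by rewrite !mxE -mulf_div divff// mul1r.
Qed.

Definition pspace_atlas : atlas 'rV[R[i]]_n :=
  Atlas pspace_open_dom pspace_parK pspace_cover pspace_open_overlap
    pspace_holo_transition.

End ProjectiveSpace.

(** * Holomorphic vector bundles *)

(* Transition data with respect to a cover.  Fibre coordinates are row vectors
   and the coordinates [s i], [s j] of one vector are related by
   [s j = s i *m trans i j]. *)
Record cocycle (R : realType) (E : normedModType R[i]) (X : atlas E)
    (r : nat) := Cocycle {
  triv : Type;
  trivial_on : triv -> set X;
  trans : triv -> triv -> X -> 'M[R[i]]_r }.

Arguments triv {R E X r} V : rename.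
Arguments trivial_on {R E X r} V i x : rename.
Arguments trans {R E X r} V i j x : rename.

Section Bundles.
Variables (R : realType) (E : normedModType R[i]) (X : atlas E).

(* Invertibility of the transition matrices follows from [trans_id] and
   [trans_mul]. *)
Record is_vbundle (r : nat) (V : cocycle X r) : Prop := IsVbundle {
  trivial_open : forall i, open_on (trivial_on V i);
  trivial_cover : forall x, exists i, trivial_on V i x;
  trans_holo : forall i j,
    holomorphic_on (trivial_on V i `&` trivial_on V j) (trans V i j);
  trans_id : forall i x, trivial_on V i x -> trans V i i x = 1%:M;
  trans_mul : forall i j k x,
    trivial_on V i x -> trivial_on V j x -> trivial_on V k x ->
    trans V i j x *m trans V j k x = trans V i k x }.

(* The two covers need not be the same: an isomorphism is given by its matrices
   in all pairs of trivializations, sending the coordinates [s i] in [V] to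
   [s i *m h i a] in [W]. *)
Definition isomorphic (r : nat) (V W : cocycle X r) : Prop :=
  exists h : triv V -> triv W -> X -> 'M[R[i]]_r,
    [/\ forall i a, holomorphic_on (trivial_on V i `&` trivial_on W a) (h i a),
        forall i a x, trivial_on V i x -> trivial_on W a x ->
          h i a x \in unitmx
      & forall i j a b x, trivial_on V i x -> trivial_on V j x ->
          trivial_on W a x -> trivial_on W b x ->
          trans V i j x *m h j b x = h i a x *m trans W a b x].

Definition tensor (r s : nat) (V : cocycle X r) (W : cocycle X s) :
    cocycle X (r * s)%N :=
  @Cocycle _ _ X (r * s)%N (triv V * triv W)
    (fun c => trivial_on V c.1 `&` trivial_on W c.2)
    (fun c d x => trans V c.1 d.1 x *t trans W c.2 d.2 x).

Definition global_section (r : nat) (V : cocycle X r)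
    (s : triv V -> X -> 'rV[R[i]]_r) : Prop :=
  (forall i, holomorphic_on (trivial_on V i) (s i)) /\
  (forall i j x, trivial_on V i x -> trivial_on V j x ->
    s j x = s i x *m trans V i j x).

(* [b] is a basis of H^0(X, V).  Values off [trivial_on V i] are junk, so
   equality of sections is only tested there. *)
Definition H0_basis (r : nat) (V : cocycle X r) (d : nat)
    (b : 'I_d -> triv V -> X -> 'rV[R[i]]_r) : Prop :=
  (forall k, global_section (b k)) /\
  (forall s : triv V -> X -> 'rV[R[i]]_r, global_section s ->
    exists! c : 'rV[R[i]]_d, forall i x, trivial_on V i x ->
      s i x = \sum_(k < d) c 0 k *: b k i x).

Definition h0_eq (r : nat) (V : cocycle X r) (d : nat) : Prop :=
  exists b, @H0_basis r V d b.

End Bundles.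

(* The bundle V_t = V|_(X x {t}), as a bundle on [X]. *)
Definition slice (R : realType) (E F : normedModType R[i]) (X : atlas E)
    (Y : atlas F) (r : nat) (V : cocycle (prod_atlas X Y) r) (t : Y) :
    cocycle X r :=
  @Cocycle _ _ X r (triv V)
    (fun i => [set x | trivial_on V i (x, t)])
    (fun i j x => trans V i j (x, t)).

(* v_b = v_a *m J for the Jacobian [J] of the change of charts, since
   [v *m 'J f x = 'd f x v]. *)
Definition tangent (R : realType) (m : nat) (X : atlas 'rV[R[i]]_m) :
    cocycle X m :=
  @Cocycle _ _ X m (chart X) (fun a => par X a @` dom X a)
    (fun a b x => 'J (chart_map X b \o par X a) (chart_map X a x)).

(* A section of O(k) is a function [F] homogeneous of degree [k] on the cone,
   represented by [F / x_i ^ k] on x_i != 0; so O(-1) is tautological. *)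
Definition twisting_sheaf (R : realType) (n : nat) (k : int) :
    cocycle (pspace_atlas R n) 1%N :=
  @Cocycle _ _ (pspace_atlas R n) 1%N 'I_n.+1
    (fun i => [set L | hcoord L 0 i != 0])
    (fun i j L => ((hcoord L 0 i / hcoord L 0 j) ^ k)%:M).

Definition twist (R : realType) (n r : nat) (V : cocycle (pspace_atlas R n) r)
    (k : int) := tensor V (twisting_sheaf R n k).

(* Main.v *)
Require Import Defs.
From mathcomp Require Import all_boot all_order all_algebra.
From mathcomp Require Import all_classical all_reals all_analysis.
From mathcomp Require Import complex mxtens ring lra zify.

Set Implicit Arguments.
Unset Strict Implicit.
Unset Printing Implicit Defensive.

Import Order.TTheory GRing.Theory Num.Theory.
Import numFieldNormedType.Exports.
Local Open Scope classical_set_scope.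
Local Open Scope ring_scope.

(** Let [x] be homogeneous coordinates on P_n, let [t] be the coordinate of the
    disc, and let S be the tridiagonal skew-symmetric matrix with entries 1 and
    -1 next to the diagonal.  The bundle is the cohomology of the monad
<<
        O --a--> O(1)^(n+1) + O(2) --b--> O(2),
        a = (x (S - t E_00), x_0^2),      b = (x, t).
>>
    It is a complex since x S x^T = 0.  The map b is onto since x <> 0, and a
    vanishes nowhere: if a = 0 then x_0 = 0, so x S = 0, and these equations
    read x_1 = 0 and x_(i+1) = x_(i-1) ([monad_inj0]).  The entry x_0^2 serves
    the case of even n, where S has a kernel, spanned by (1, 0, 1, ..., 0, 1).

    For t <> 0 the equation b = 0 determines the component in O(2), the matrix
    S - t E_00 is invertible ([monad_inj]), and the cohomology is the cokernel
    of x : O -> O(1)^(n+1), which is the tangent bundle by the Euler sequence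
    ([slice_tangent]).

    For t = 0 the summand O(2) lies in the kernel of b, and it gives a nonzero
    section of V_0(-2) ([central_section]).  Conversely a section of V_0(-2) is
    locally a pair (w, f) modulo multiples of a, with x w^T = 0.  The bivector
    formed by w and x S is unchanged when a multiple of a is added, and it is
    homogeneous of degree 0, so it is constant ([wedge_const]).  Its contraction
    with x is zero, because x w^T = 0 and x S x^T = 0; as x is arbitrary the
    bivector is 0 ([wedge_lift1]).  Off the kernel of S this gives w = g x S,
    and f - g x_0^2 is a well defined holomorphic function of degree 0 there.
    It is constant along each line that avoids the kernel, which is at most one
    point, hence it is a constant c ([corr_const]), and the section is c times
    the section above, also at the missing point by continuity
    ([section_scalar]).

    The same bivector with x in place of x S shows that T(-2) has no section:
    its exterior product with x is zero, which kills a constant bivector when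
    n >= 2.  So an isomorphism from V_0 to T would have to kill
    [central_section] ([central_not_tangent]).

    The analytic input is that a holomorphic function on a projective line is
    constant ([entire_two_charts]).  Holomorphic only means complex
    differentiable, so Goursat's theorem is needed ([goursat]): for G entire,
    the integral of G(e^(x + i y)) over one period in y does not depend on x.
    It tends to 2 pi G(0) when x tends to -oo, and to 2 pi times the value of G
    at infinity when x tends to +oo. *)
(** * Goursat's theorem for closed real forms *)

(** Values of primitives replace integrals below: additivity is then telescoping,
    and bounds come from the mean value theorem. *)
Lemma continuous_primitive (R : realType) (f : R -> R) (m : R) : continuous f ->
  exists F : R -> R, forall x, m < x -> is_derive x 1 F (f x).
Proof.
move=> cf; exists (fun y => \int[lebesgue_measure]_(t in `[m, y]) f t).
move=> x mx; have xu : x < x + 1 by rewrite ltrDl.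
have fi : lebesgue_measure.-integrable `[m, x + 1] (EFin \o f).
  apply: continuous_compact_integrable; first exact: segment_compact.
  exact: continuous_subspaceT.
have [dF F'] := continuous_FTC1_closed xu fi mx (cf x).
by rewrite -F' derive1E; apply: derivableP.
Qed.

Lemma primitive_affine_le (R : realType) (F f : R -> R) (a b u c d M : R) :
  a <= b -> (forall x, a <= x <= b -> is_derive x 1 F (f x)) ->
  (forall x, a <= x <= b -> `|f x - (c + d * (x - u))| <= M) ->
  `|F b - F a - (c * (b - a) + d * ((b - u) ^+ 2 - (a - u) ^+ 2) / 2)| <=
    M * (b - a).
Proof.
move=> ab dF fM.
pose G x := F x - (c * x + d / 2 * (x - u) ^+ 2).
have dG x : a <= x <= b -> is_derive x 1 G (f x - (c + d * (x - u))).
  move=> /dF dFx; rewrite /G; apply: is_derive_eq.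
  by rewrite /GRing.scale /=; field.
have [||z /itvP zab GE] := @MVT_segment R G (fun x => f x - (c + d * (x - u))) _ _ ab.
- by move=> s /itvP xab; apply: dG; rewrite !xab.
- apply: derivable_within_continuous => s /itvP xab.
  by have [] := dG s _; rewrite ?xab.
have -> : F b - F a - (c * (b - a) + d * ((b - u) ^+ 2 - (a - u) ^+ 2) / 2) =
   G b - G a by rewrite /G; field.
rewrite GE normrM [`|b - a|]ger0_norm ?subr_ge0//.
by apply: ler_wpM2r; [rewrite subr_ge0|apply: fM; rewrite !zab].
Qed.

Lemma nested_intervals (R : realType) (x : nat -> R) (w : R) : 0 < w ->
  (forall k, x k <= x k.+1 <= x k + w / 2 ^+ k.+1) ->
  exists u, forall k, x k <= u <= x k + w / 2 ^+ k.
Proof.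
move=> w0 xk.
have mono i j : (i <= j)%N -> x i <= x j.
  move=> ij; apply: (homo_leq (r := <=%R)) ij => // [?|i0].
    exact: le_trans.
  by have /andP[] := xk i0.
have anti i j : (i <= j)%N -> x j + w / 2 ^+ j <= x i + w / 2 ^+ i.
  move=> ij; pose f k := x k + w / 2 ^+ k.
  apply: (@homo_leq _ f (fun a b => b <= a)) ij => //.
    by move=> b a c ab bc; exact: le_trans bc ab.
  move=> k; rewrite /f.
  have /andP[_ H] := xk k; apply: (le_trans (lerD H (lexx _))).
  rewrite -addrA lerD2l exprS invfM; set t := (2 ^+ k)^-1; lra.
have ub i j : x i <= x j + w / 2 ^+ j.
  have [ij|/ltnW ji] := leqP i j.
    apply: (le_trans (mono _ _ ij)); rewrite lerDl divr_ge0 ?ltW// exprn_gt0//.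
  by apply: le_trans (anti _ _ ji); rewrite lerDl divr_ge0 ?ltW// exprn_gt0.
have hs : has_sup (range x).
  split; first by exists (x 0%N), 0%N.
  by exists (x 0%N + w / 2 ^+ 0) => _ [i _ <-].
exists (sup (range x)) => k; apply/andP; split.
  by apply: ub_le_sup; [case: hs|exists k].
by apply: ge_sup; [case: hs|move=> _ [i _ <-]].
Qed.

(** The form P dx + Q dy has a first order expansion at every point, with the
    same coefficient b of dy in P and of dx in Q.  No continuity of the
    derivatives is asked: for complex differentiable functions it is not known
    in advance. *)
Definition closed_form (R : realType) (P Q : R -> R -> R) := forall x0 y0,
  exists a b c, forall e, 0 < e -> exists2 d, 0 < d & forall x y,
    `|x - x0| <= d -> `|y - y0| <= d ->
    `|P x y - (P x0 y0 + a * (x - x0) + b * (y - y0))|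
       <= e * (`|x - x0| + `|y - y0|) /\
    `|Q x y - (Q x0 y0 + b * (x - x0) + c * (y - y0))|
       <= e * (`|x - x0| + `|y - y0|).

Section Goursat.
Variables (R : realType) (P Q A B : R -> R -> R) (m : R).
Hypothesis PQ : closed_form P Q.
Hypothesis dA : forall y x, m < x -> is_derive x 1 (A y) (P x y).
Hypothesis dB : forall x y, m < y -> is_derive y 1 (B x) (Q x y).

(* The circulation around the rectangle with corners (x0, y0) and (x1, y1); the
   functions A y and B x are primitives of P(., y) and Q(x, .), on half-lines. *)
Let circ x0 x1 y0 y1 := A y0 x1 - A y0 x0 + (B x1 y1 - B x1 y0)
  - (A y1 x1 - A y1 x0) - (B x0 y1 - B x0 y0).

(** The affine part of the form contributes nothing, because of the common
    coefficient b, so only the error term of the expansion is left. *)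
Lemma circulation_le u v e : 0 < e -> exists2 d, 0 < d & forall x y w h,
  m < x -> m < y -> x <= u <= x + w -> y <= v <= y + h -> w <= d -> h <= d ->
  `|circ x (x + w) y (y + h)| <= e * (w + h) ^+ 2.
Proof.
move=> e0; have [a [b [c /(_ (e / 2) _)[|d d0 PQd]]]] := PQ u v.
  by rewrite divr_gt0.
exists d => // x y w h mx my /andP[xu ux] /andP[yv vy] wd hd.
have w0 : 0 <= w by lra.
have h0 : 0 <= h by lra.
have bd s t : x <= s <= x + w -> y <= t <= y + h ->
    `|P s t - (P u v + a * (s - u) + b * (t - v))| <= e / 2 * (w + h) /\
    `|Q s t - (Q u v + b * (s - u) + c * (t - v))| <= e / 2 * (w + h).
  move=> /andP[xs sx] /andP[yt ty].
  have su : `|s - u| <= w by rewrite ler_norml; lra.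
  have tv : `|t - v| <= h by rewrite ler_norml; lra.
  have [] := PQd s t; [lra|lra|].
  move=> p q; split.
    by apply: (le_trans p); apply: ler_wpM2l; lra.
  by apply: (le_trans q); apply: ler_wpM2l; lra.
have hor t : y <= t <= y + h -> `|A t (x + w) - A t x - ((P u v + b * (t - v)) *
   (x + w - x) + a * ((x + w - u) ^+ 2 - (x - u) ^+ 2) / 2)|
   <= e / 2 * (w + h) * (x + w - x).
  move=> yt; apply: (@primitive_affine_le _ _ (fun s => P s t)).
  - lra.
  - by move=> s ?; apply: dA; lra.
  - move=> s xs; have [+ _] := bd s t xs yt.
    by rewrite [_ + b * _ + _]addrAC.
have ver s : x <= s <= x + w -> `|B s (y + h) - B s y - ((Q u v + b * (s - u)) *
   (y + h - y) + c * ((y + h - v) ^+ 2 - (y - v) ^+ 2) / 2)|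
   <= e / 2 * (w + h) * (y + h - y).
  move=> xs; apply: (@primitive_affine_le _ _ (fun t => Q s t)).
  - lra.
  - by move=> t ?; apply: dB; lra.
  - by move=> t yt; have [_ +] := bd s t xs yt.
have H1 := hor y ltac:(lra); have H2 := hor (y + h) ltac:(lra).
have V1 := ver x ltac:(lra); have V2 := ver (x + w) ltac:(lra).
move: H1 H2 V1 V2; rewrite /circ !ler_norml.
set a1 := A _ _; set a2 := A _ _; set a3 := A _ _; set a4 := A _ _.
set b1 := B _ _; set b2 := B _ _; set b3 := B _ _; set b4 := B _ _.
by move=> *; nra.
Qed.

Lemma rectangle_quarter x y w h eta : 0 < w -> 0 < h ->
  eta * (w * h) <= `|circ x (x + w) y (y + h)| ->
  exists x' y', [/\ x <= x' <= x + w / 2, y <= y' <= y + h / 2 &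
   eta * (w / 2 * (h / 2)) <= `|circ x' (x' + w / 2) y' (y' + h / 2)|].
Proof.
move=> w0 h0 le; apply: contrapT => /forallNP none.
have q x' y' : x <= x' <= x + w / 2 -> y <= y' <= y + h / 2 ->
   `|circ x' (x' + w / 2) y' (y' + h / 2)| < eta * (w / 2 * (h / 2)).
  move=> hx hy; rewrite ltNge; apply/negP => le'.
  by have /forallNP/(_ y') := none x'; apply.
have q1 := q x y ltac:(lra) ltac:(lra).
have q2 := q (x + w / 2) y ltac:(lra) ltac:(lra).
have q3 := q x (y + h / 2) ltac:(lra) ltac:(lra).
have q4 := q (x + w / 2) (y + h / 2) ltac:(lra) ltac:(lra).
move: q1 q2 q3 q4 le.
have -> : x + w / 2 + w / 2 = x + w by field.
have -> : y + h / 2 + h / 2 = y + h by field.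
have -> : circ x (x + w) y (y + h) = circ x (x + w / 2) y (y + h / 2) +
  circ (x + w / 2) (x + w) y (y + h / 2) + circ x (x + w / 2) (y + h / 2) (y + h) +
  circ (x + w / 2) (x + w) (y + h / 2) (y + h) by rewrite /circ; ring.
move=> q1 q2 q3 q4 /le_trans/(_ (ler_normD _ _)).
have := ler_normD (circ x (x + w / 2) y (y + h / 2) +
  circ (x + w / 2) (x + w) y (y + h / 2)) (circ x (x + w / 2) (y + h / 2) (y + h)).
have := ler_normD (circ x (x + w / 2) y (y + h / 2))
  (circ (x + w / 2) (x + w) y (y + h / 2)).
by move=> *; lra.
Qed.

(** Bisection: if the circulation is not 0, nested quarters keep its ratio to the
    area, whereas [circulation_le] makes this ratio small near the limit point. *)
Lemma goursat x y w h : m < x -> m < y -> 0 < w -> 0 < h ->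
  circ x (x + w) y (y + h) = 0.
Proof.
move=> mx my w0 h0; apply/eqP; rewrite -normr_eq0 -[_ == 0]negbK; apply/negP => I0.
have Ip : 0 < `|circ x (x + w) y (y + h)| by rewrite lt_def I0 normr_ge0.
pose eta := `|circ x (x + w) y (y + h)| / (w * h).
have eta0 : 0 < eta by rewrite divr_gt0// mulr_gt0.
pose S (k : nat) (p q : R * R) := p.1 <= q.1 <= p.1 + w / 2 ^+ k.+1 /\
  p.2 <= q.2 <= p.2 + h / 2 ^+ k.+1.
pose T (k : nat) (p : R * R) := [/\ m < p.1, m < p.2 &
  eta * (w / 2 ^+ k * (h / 2 ^+ k)) <=
  `|circ p.1 (p.1 + w / 2 ^+ k) p.2 (p.2 + h / 2 ^+ k)|].
have step k p : exists q, T k p -> S k p q /\ T k.+1 q.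
  have [Tp|nT] := pselect (T k p); last by exists p.
  case: Tp => mp1 mp2 Ik.
  have [||x' [y' [hx hy le]]] := rectangle_quarter _ _ Ik.
  - by rewrite divr_gt0// exprn_gt0.
  - by rewrite divr_gt0// exprn_gt0.
  exists (x', y') => _; rewrite /S /T /= exprSr !invfM !mulrA; split => //.
  move: hx hy => /andP[? ?] /andP[? ?].
  split=> //; first exact: lt_le_trans mp1 _.
    exact: lt_le_trans mp2 _.
  by rewrite -!mulrA in le *.
have [next nextP] := choice (fun kp : nat * (R * R) => step kp.1 kp.2).
pose p := fix p k := if k is k'.+1 then next (k', p k') else (x, y).
have Tp k : T k (p k).
  elim: k => [|k IH].
    rewrite /T /= expr0 !divr1; split=> //.
    by rewrite /eta divfK// mulf_neq0 ?gt_eqF.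
  by have /= [] := nextP (k, p k) IH.
have Sp k : S k (p k) (p k.+1) by have /= [] := nextP (k, p k) (Tp k).
have [u uP] := nested_intervals w0 (fun k => (Sp k).1).
have [v vP] := nested_intervals h0 (fun k => (Sp k).2).
(* With w t and h t for the sides, this accuracy bounds the circulation by half
   of eta times the area. *)
have [|d d0 dP] := @circulation_le u v (eta * (w * h) / (2 * (w + h) ^+ 2)).
  apply: divr_gt0; first by do 2 apply: mulr_gt0 => //.
  by apply: mulr_gt0 => //; apply: exprn_gt0; apply: addr_gt0.
have [k kP] : exists k, (w + h) / 2 ^+ k < d.
  have : (w + h) / d < (2 ^ Num.bound ((w + h) / d))%:R.
    have wd : 0 <= (w + h) / d by apply: divr_ge0; lra.
    apply: (lt_le_trans (archi_boundP wd)).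
    by rewrite ler_nat ltnW// ltn_expl.
  rewrite natrX => H; exists (Num.bound ((w + h) / d)).
  by rewrite ltr_pdivrMr ?exprn_gt0// mulrC -ltr_pdivrMr.
have [m1 m2 le] := Tp k.
have t0 : 0 < (2 ^+ k : R)^-1 by rewrite invr_gt0 exprn_gt0.
set t := _^-1 in kP le t0 *.
have := dP (p k).1 (p k).2 (w * t) (h * t) m1 m2 (uP k) (vP k).
have wt := mulr_gt0 w0 t0; have ht := mulr_gt0 h0 t0.
rewrite mulrDl in kP.
move=> /(_ ltac:(lra) ltac:(lra)) /(le_trans le).
have -> : eta * (w * h) / (2 * (w + h) ^+ 2) * (w * t + h * t) ^+ 2 =
  eta * (w * h) * t ^+ 2 / 2 by field; lra.
have : 0 < eta * (w * h) * t ^+ 2.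
  by apply: mulr_gt0; [do 2 apply: mulr_gt0 => //|apply: exprn_gt0].
by move=> ? ?; lra.
Qed.

End Goursat.

(** * The complex exponential and holomorphic functions on a cylinder *)

Lemma differentiable_expansion (K : numFieldType) (f : K -> K) (x : K) :
  differentiable f x -> forall e, 0 < e -> exists2 d, 0 < d & forall h,
  `|h| <= d -> `|f (x + h) - f x - 'd f x 1 * h| <= e * `|h|.
Proof.
move=> df; have /diff_locallyP[_ /eqaddoP fx] := df; move=> e e0.
have /nbhs_ballP[r /= r0 rP] := fx e e0.
exists (r / 2); first by rewrite divr_gt0.
move=> h hr; have := rP h; rewrite -ball_normE /ball_ /= sub0r normrN !fctE.
have -> : 'd f x h = 'd f x 1 * h.
  by rewrite !diff1E// /GRing.scale /= mul1r mulrC.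
rewrite opprD addrA [h + x]addrC; apply.
by apply: le_lt_trans hr _; rewrite ltr_pdivrMr// ltr_pMr// ltr1n.
Qed.

Lemma ler_of_eq (R : numDomainType) (x y : R) : x = y -> x <= y.
Proof. by move=> ->. Qed.

Lemma is_derive_expansion (R : realType) (f : R -> R) (x a : R) :
  is_derive x 1 f a -> forall e, 0 < e -> exists2 d, 0 < d & forall h,
  `|h| <= d -> `|f (x + h) - f x - a * h| <= e * `|h|.
Proof.
move=> fa; have df : differentiable f x by apply/derivable1_diffP.
have <- : 'd f x 1 = a by rewrite -deriveE// derive_val.
exact: differentiable_expansion.
Qed.

Section ComplexExponential.
Local Open Scope complex_scope.

Lemma normc_leD (R : realType) (a b : R) : `|a +i* b| <= (`|a| + `|b|)%:C.
Proof.
rewrite (complexE (a +i* b)) /= rmorphD; apply: (le_trans (ler_normD _ _)).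
apply: lerD; rewrite ?normrM !normc_def /= ?expr0n ?addr0 ?add0r ?expr1n.
  by rewrite sqrtr_sqr.
by rewrite sqrtr1 mul1r sqrtr_sqr.
Qed.

Lemma normc_geReIm (R : realType) (z : R[i]) :
  (`|complex.Re z|)%:C <= `|z| /\ (`|complex.Im z|)%:C <= `|z|.
Proof.
split; first exact: normc_ge_Re.
by rewrite normc_def lecR -sqrtr_sqr ler_wsqrtr// lerDr sqr_ge0.
Qed.

(** The complex exponential of x + i y. *)
Definition cexp (R : realType) (x y : R) : R[i] :=
  (expR x * cos y) +i* (expR x * sin y).

Lemma normr_cexp (R : realType) (x y : R) : `|cexp x y| = (expR x)%:C.
Proof.
by rewrite normc_def /= !exprMn -mulrDr cos2Dsin2 mulr1 sqrtr_sqr ger0_norm.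
Qed.

Lemma cexpN (R : realType) (x y : R) : cexp x y * cexp (- x) (- y) = 1.
Proof.
rewrite /cexp cosN sinN; apply/eqP; rewrite eq_complex /=; apply/andP.
have e1 : expR x * expR (- x) = 1 by rewrite expRN divff// gt_eqF ?expR_gt0.
split; apply/eqP; last by ring.
rewrite (_ : _ - _ = (expR x * expR (- x)) * (cos y ^+ 2 + sin y ^+ 2)).
  by rewrite e1 cos2Dsin2 mul1r.
by ring.
Qed.

(** Applied to f = cos and f = sin, this gives both components of [cexp]. *)
Lemma expR_trig_expansion (R : realType) (f : R -> R) (x0 y0 g : R) :
  (forall y, `|f y| <= 1) -> `|g| <= 1 -> is_derive y0 1 f g ->
  forall e, 0 < e -> exists2 d, 0 < d & forall x y,
  `|x - x0| <= d -> `|y - y0| <= d ->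
  `|expR x * f y - (expR x0 * (f y0 + f y0 * (x - x0) + g * (y - y0)))|
     <= e * (`|x - x0| + `|y - y0|).
Proof.
move=> f1 g1 df e e0.
have E0 := expR_gt0 x0; set E := expR x0 in E0 *.
pose e' := e / (3 * E).
have e'0 : 0 < e' by apply: divr_gt0 => //; apply: mulr_gt0.
have [d1 d10 d1P] := is_derive_expansion (is_derive_expR 0) e'0.
have [d2 d20 d2P] := is_derive_expansion df e'0.
exists (Num.min (Num.min d1 d2) (Num.min e' 1)).
  by rewrite !lt_min d10 d20 e'0 ltr01.
move=> x y; rewrite !le_min => /andP[/andP[xd1 _] /andP[xe x1]].
move=> /andP[/andP[_ yd2] /andP[ye y1]].
have := d1P _ xd1; have := d2P _ yd2; rewrite add0r [y0 + _]addrC subrK.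
rewrite expR0 mul1r.
set dx := x - x0 in xd1 xe x1 *; set dy := y - y0 in yd2 ye y1 *.
have -> : expR x = E * expR dx by rewrite -expRD addrC subrK.
set v := f y - _ - _ => Hv; set u := expR dx - _ - _ => Hu.
have -> : E * expR dx * f y - E * (f y0 + f y0 * dx + g * dy) =
   E * (u * f y + (1 + dx) * v + dx * dy * g).
  by rewrite /u /v; ring.
have -> : e = 3 * E * e' by rewrite /e' mulrC divfK// mulf_neq0// gt_eqF.
have -> (s : R) : 3 * E * e' * s = E * (3 * e' * s) by ring.
rewrite normrM gtr0_norm// ler_pM2l//.
apply: (le_trans (ler_normD _ _)).
apply: (le_trans (lerD (ler_normD _ _) (lexx _))); rewrite -mulrA !normrM.
have b1 : `|u| * `|f y| <= e' * `|dx|.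
  by rewrite -[leRHS]mulr1 ler_pM.
have b2 : `|1 + dx| * `|v| <= 2 * (e' * `|dy|).
  apply: ler_pM => //; apply: (le_trans (ler_normD _ _)).
  by rewrite normr1; lra.
have b3 : `|dx| * (`|dy| * `|g|) <= e' * `|dx|.
  rewrite mulrC; apply: ler_wpM2r => //.
  by rewrite -[leRHS]mulr1 ler_pM.
have ex : 0 <= e' * `|dx| by rewrite mulr_ge0// ltW.
have ey : 0 <= e' * `|dy| by rewrite mulr_ge0// ltW.
by lra.
Qed.

Lemma normr_sin_le1 (R : realType) (y : R) : `|sin y| <= 1.
Proof. by rewrite ler_norml sin_geN1 sin_le1. Qed.

Lemma normr_cos_le1 (R : realType) (y : R) : `|cos y| <= 1.
Proof. by rewrite ler_norml cos_geN1 cos_le1. Qed.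

Lemma cexp_expansion (R : realType) (x0 y0 e : R) : 0 < e ->
  exists2 d, 0 < d & forall x y, `|x - x0| <= d -> `|y - y0| <= d ->
  `|cexp x y - cexp x0 y0 - cexp x0 y0 * ((x - x0) +i* (y - y0))|
    <= (e * (`|x - x0| + `|y - y0|))%:C.
Proof.
move=> e0; have e20 : 0 < e / 2 by rewrite divr_gt0.
have sN : `|- sin y0| <= 1 by rewrite normrN normr_sin_le1.
have [d1 d10 d1P] := expR_trig_expansion x0 (@normr_cos_le1 R) sN
  (is_derive_cos y0) e20.
have [d2 d20 d2P] := expR_trig_expansion x0 (@normr_sin_le1 R)
  (normr_cos_le1 y0) (is_derive_sin y0) e20.
exists (Num.min d1 d2); first by rewrite lt_min d10.
move=> x y; rewrite !le_min => /andP[x1 x2] /andP[y1 y2].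
set z := (X in `|X|).
have -> : z = (complex.Re z) +i* (complex.Im z) by case: z.
apply: (le_trans (normc_leD _ _)); rewrite lecR.
have := lerD (d1P x y x1 y1) (d2P x y x2 y2).
rewrite -mulrDl -splitr; apply: le_trans.
apply: ler_of_eq; congr (_ + _); apply: congr1; rewrite /z /cexp /=; ring.
Qed.

(** The form is the imaginary part of G(e^z) dz, and its closedness amounts to the
    Cauchy-Riemann equations of z |-> G(e^z). *)
Lemma closed_form_entire_cexp (R : realType) (G : R[i] -> R[i]) :
  (forall z, differentiable G z) ->
  closed_form (fun x y => complex.Im (G (cexp x y)))
    (fun x y => complex.Re (G (cexp x y))).
Proof.
move=> dG x0 y0; set w0 := cexp x0 y0.
pose ga := 'd G w0 1 * w0.
exists (complex.Im ga), (complex.Re ga), (- complex.Im ga) => e e0.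
pose D := complex.Re `|'d G w0 1|.
have DE : `|'d G w0 1| = D%:C by rewrite /D normc_def.
have D0 : 0 <= D by rewrite -ler0c -DE.
pose W := expR x0.
have W0 : 0 < W := expR_gt0 x0.
(* The accuracies e1 for G and e2 for the exponential satisfy
   e1 (W + 1) + D e2 <= e. *)
pose e1 := e / 2 / (W + 1).
pose e2 := Num.min 1 (e / 2 / (D + 1)).
have e20 : 0 < e2 by rewrite lt_min ltr01; apply: divr_gt0; lra.
have e10 : 0 < e1 by apply: divr_gt0; lra.
have e10c : 0 < e1%:C by rewrite ltcR.
have [d1 d10 d1P] := differentiable_expansion (dG w0) e10c.
have [d2 d20 d2P] := cexp_expansion x0 y0 e20.
have d1E : d1 = (complex.Re d1)%:C by rewrite RRe_real// gtr0_real.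
have d1r : 0 < complex.Re d1 by rewrite -ltcR -d1E.
exists (Num.min d2 (complex.Re d1 / 2 / (W + 1))).
  by rewrite lt_min d20; apply: divr_gt0; lra.
move=> x y; rewrite !le_min => /andP[xd2 xd1] /andP[yd2 yd1].
set h := (x - x0) +i* (y - y0).
set N := `|x - x0| + `|y - y0|.
have N0 : 0 <= N by rewrite addr_ge0.
have hN : `|h| <= N%:C by exact: normc_leD.
have := d2P x y xd2 yd2; rewrite -/w0 -/h -/N => Hw.
set dw := cexp x y - w0 in Hw.
have dwN : `|dw| <= ((W + 1) * N)%:C.
  have -> : dw = w0 * h + (dw - w0 * h) by rewrite addrC subrK.
  apply: (le_trans (ler_normD _ _)); rewrite mulrDl rmorphD; apply: lerD.
    by rewrite normrM normr_cexp rmorphM; apply: ler_wpM2l => //; rewrite lecR ltW.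
  apply: (le_trans Hw); rewrite lecR; apply: ler_wpM2r => //.
  by rewrite ge_min lexx.
have dwd : `|dw| <= d1.
  apply: (le_trans dwN); rewrite d1E lecR mulrC -ler_pdivlMr; last lra.
  by rewrite /N [leRHS](_ : _ = complex.Re d1 / 2 / (W + 1) + complex.Re d1 / 2 / (W + 1));
    [rewrite lerD|field; lra].
have := d1P _ dwd; rewrite [w0 + dw]addrC subrK => HG.
have {HG} : `|G (cexp x y) - G w0 - ga * h| <= (e * N)%:C.
  have -> : G (cexp x y) - G w0 - ga * h =
     (G (cexp x y) - G w0 - 'd G w0 1 * dw) + 'd G w0 1 * (dw - w0 * h).
    by rewrite /ga; ring.
  apply: (le_trans (ler_normD _ _)); rewrite normrM DE.
  apply: (@le_trans _ _ ((e1 * ((W + 1) * N))%:C + (D * (e2 * N))%:C)).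
    apply: lerD.
      by apply: (le_trans HG); rewrite (rmorphM _ e1); apply: ler_wpM2l => //; rewrite ltW.
    by rewrite [X in _ <= X](rmorphM _ D); apply: ler_wpM2l => //; rewrite lecR.
  rewrite -rmorphD lecR.
  have -> : e1 * ((W + 1) * N) = e / 2 * N by rewrite /e1; field; lra.
  have De : D * e2 <= e / 2.
    apply: (@le_trans _ _ (D * (e / 2 / (D + 1)))).
      by rewrite ler_wpM2l// ge_min lexx orbT.
    rewrite mulrCA ger_pMr ?divr_gt0// ler_pdivrMr; lra.
  rewrite [D * _]mulrA; have := ler_wpM2r N0 De; lra.
move=> H; have [HR HI] := normc_geReIm (G (cexp x y) - G w0 - ga * h).
have := le_trans HR H; have := le_trans HI H; rewrite !lecR => {}HI {}HR.
split.
- apply: le_trans HI; apply: ler_of_eq; apply: congr1.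
  rewrite !raddfB /= /h; case: (ga) => a b /=; ring.
- apply: le_trans HR; apply: ler_of_eq; apply: congr1.
  rewrite !raddfB /= /h; case: (ga) => a b /=; ring.
Qed.

Lemma closed_form_continuous (R : realType) (P Q : R -> R -> R) :
  closed_form P Q ->
  (forall y, continuous (fun x => P x y)) /\ (forall x, continuous (Q x)).
Proof.
move=> PQ; split.
- move=> y x0; have [a [b [c /(_ 1 ltr01)[d d0 dP]]]] := PQ x0 y.
  apply/cvgrPdist_le => e e0; near=> x.
  have xd : `|x - x0| <= d by rewrite distrC; near: x; exact: cvgr_dist_le.
  have xe : `|x - x0| <= e / (`|a| + 1).
    rewrite distrC; near: x; apply: cvgr_dist_le => //.
    by apply: divr_gt0 => //; apply: ltr_wpDl.
  have [] := dP x y xd _; first by rewrite subrr normr0 ltW.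
  rewrite subrr mulr0 addr0 normr0 addr0 mul1r => H _.
  rewrite distrC (_ : _ - _ = (P x y - (P x0 y + a * (x - x0))) + a * (x - x0)); last by ring.
  apply: (le_trans (ler_normD _ _)); rewrite normrM.
  rewrite ler_pdivlMr in xe; last by apply: ltr_wpDl.
  by have := H; lra.
- move=> x y0; have [a [b [c /(_ 1 ltr01)[d d0 dP]]]] := PQ x y0.
  apply/cvgrPdist_le => e e0; near=> y.
  have yd : `|y - y0| <= d by rewrite distrC; near: y; exact: cvgr_dist_le.
  have ye : `|y - y0| <= e / (`|c| + 1).
    rewrite distrC; near: y; apply: cvgr_dist_le => //.
    by apply: divr_gt0 => //; apply: ltr_wpDl.
  have [] := dP x y _ yd; first by rewrite subrr normr0 ltW.
  rewrite subrr !mulr0 !addr0 normr0 add0r mul1r => _ H.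
  rewrite distrC (_ : _ - _ = (Q x y - (Q x y0 + c * (y - y0))) + c * (y - y0)); last by ring.
  apply: (le_trans (ler_normD _ _)); rewrite normrM.
  rewrite ler_pdivlMr in ye; last by apply: ltr_wpDl.
  by have := H; lra.
Unshelve. all: by end_near. Qed.

(** The horizontal sides of a rectangle of height one period cancel, so the
    integral of Q over a period is the same at both ends; it is p u up to p e at
    one end and p v up to p e at the other. *)
Lemma closed_form_periodic_le (R : realType) (P Q : R -> R -> R) (p x0 w u v e : R) :
  0 < p -> 0 < w -> closed_form P Q -> (forall x, P x p = P x 0) ->
  (forall y, `|Q x0 y - u| <= e) -> (forall y, `|Q (x0 + w) y - v| <= e) ->
  `|u - v| <= 2 * e.
Proof.
move=> p0 w0 PQ Pp Qu Qv; have [cP cQ] := closed_form_continuous PQ.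
(* The primitives are needed on half-lines that contain x0 and 0. *)
pose m := Num.min (x0 - 1) (- 1).
have prim_ex (f : R -> R) : exists F : R -> R, continuous f ->
    forall x, m < x -> is_derive x 1 F (f x).
  have [cf|ncf] := pselect (continuous f); last by exists f.
  by have [F FP] := continuous_primitive m cf; exists F.
have [prim primP] := choice prim_ex.
pose A y := prim (P^~ y); pose B x := prim (Q x).
have mx : m < x0 by rewrite /m gt_min; apply/orP; left; lra.
have m0 : m < 0 by rewrite /m gt_min; apply/orP; right; lra.
have dB x y : m < y -> is_derive y 1 (B x) (Q x y) by move=> ?; exact: primP.
have := @goursat R P Q A B m PQ (fun y x => primP (P^~ y) (cP y) x) dB x0 0 w p mx m0 w0 p0.
(* Equal functions have been given equal primitives. *)
have -> : A (0 + p) = A 0 by rewrite add0r /A; congr prim; apply/funext => x.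
rewrite add0r => E.
have E2 : B (x0 + w) p - B (x0 + w) 0 = B x0 p - B x0 0 by lra.
have est x s : (forall y, `|Q x y - s| <= e) ->
    `|B x p - B x 0 - s * p| <= e * p.
  move=> Qs; have := @primitive_affine_le R (B x) (Q x) 0 p 0 s 0 e (ltW p0).
  rewrite !subr0 mul0r mul0r addr0; apply.
    by move=> y /andP[y0 _]; apply: dB; apply: lt_le_trans y0.
  by move=> y _; rewrite mul0r addr0.
have := est _ _ Qu; have := est _ _ Qv; rewrite E2 => e1 e2.
rewrite -(ler_pM2r p0) -{1}[p]gtr0_norm// -normrM.
have -> : (u - v) * p = (B x0 p - B x0 0 - v * p) - (B x0 p - B x0 0 - u * p) by ring.
by apply: (le_trans (ler_normB _ _)); lra.
Qed.

Lemma cexp_neq0 (R : realType) (x y : R) : cexp x y != 0.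
Proof.
apply/eqP => E; have := cexpN x y; rewrite E mul0r => /eqP.
by rewrite eq_sym oner_eq0.
Qed.

Lemma cexp_near0 (R : realType) (G : R[i] -> R[i]) (e : R) : 0 < e ->
  (forall z, differentiable G z) ->
  exists X, forall x y, x <= X -> `|complex.Re (G (cexp x y)) - complex.Re (G 0)| <= e.
Proof.
move=> e0 dG; have := differentiable_continuous (dG 0).
move=> /cvgrPdist_le/(_ e%:C); rewrite ltcR => /(_ e0).
move=> /nbhs_ballP[r /= r0 rP].
have rE : r = (complex.Re r)%:C by rewrite RRe_real// gtr0_real.
have rr : 0 < complex.Re r by rewrite -ltcR -rE.
exists (ln (complex.Re r / 2)) => x y xX.
have := rP (cexp x y); rewrite -ball_normE /ball_ /= sub0r normrN normr_cexp.
rewrite [X in _ < X]rE ltcR.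
have -> : expR x < complex.Re r.
  apply: (@le_lt_trans _ _ (complex.Re r / 2)); last lra.
  by rewrite -[leRHS]lnK ?ler_expR// posrE; lra.
move=> /(_ isT); rewrite distrC => H.
have [+ _] := normc_geReIm (G (cexp x y) - G 0).
by move=> /le_trans/(_ H); rewrite lecR raddfB.
Qed.

Lemma entire_two_charts_Re (R : realType) (G G' : R[i] -> R[i]) :
  (forall z, differentiable G z) -> (forall z, differentiable G' z) ->
  (forall z, z != 0 -> G z = G' z^-1) -> complex.Re (G 0) = complex.Re (G' 0).
Proof.
move=> dG dG' GG'; apply/eqP; rewrite -subr_eq0 -normr_le0.
apply/ler_addgt0Pr => e e0; rewrite add0r.
have e20 : 0 < e / 2 by apply: divr_gt0.
have [X XP] := cexp_near0 e20 dG; have [X' XP'] := cexp_near0 e20 dG'.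
have cN x y : (cexp x y : R[i])^-1 = cexp (- x) (- y).
  by apply: (mulfI (cexp_neq0 x y)); rewrite divff ?cexp_neq0// cexpN.
pose x0 := Num.min X (- X' - 1).
(* The interval from x0 to x0 + w reaches from below X to above - X'. *)
pose w := `|X'| + `|x0| + 1.
have -> : e = 2 * (e / 2) by field.
apply: (@closed_form_periodic_le R (fun x y => complex.Im (G (cexp x y)))
  (fun x y => complex.Re (G (cexp x y))) (pi *+ 2) x0 w).
- by rewrite pmulrn_lgt0// pi_gt0.
- by rewrite /w; have := normr_ge0 X'; have := normr_ge0 x0; lra.
- exact: closed_form_entire_cexp.
- by move=> x; rewrite /cexp cos2pi sin2pi cos0 sin0.
- by move=> y; apply: XP; rewrite ge_min lexx.
- move=> y; rewrite GG' ?cexp_neq0// cN.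
  apply: XP'; rewrite /w; have := ler_norm (- X'); have := ler_norm (- x0).
  by rewrite !normrN; lra.
Qed.

(** The functions G and G' are the expressions of one function in the two standard
    charts of the projective line, and the points 0 and infinity are arbitrary:
    a holomorphic function on the projective line is constant. *)
Lemma entire_two_charts (R : realType) (G G' : R[i] -> R[i]) :
  (forall z, differentiable G z) -> (forall z, differentiable G' z) ->
  (forall z, z != 0 -> G z = G' z^-1) -> G 0 = G' 0.
Proof.
move=> dG dG' GG'; apply/eqP; rewrite eq_complex; apply/andP; split; apply/eqP.
  exact: entire_two_charts_Re.
(* The imaginary part of F is the real part of - i F. *)
have dM (F : R[i] -> R[i]) : (forall z, differentiable F z) ->
    forall z, differentiable (fun z => - 'i * F z) z.
  by move=> dF z; apply: differentiableM => //; exact: differentiable_cst.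
have := entire_two_charts_Re (dM _ dG) (dM _ dG').
move=> /(_ (fun z z0 => congr1 _ (GG' z z0))).
case: (G 0) (G' 0) => [a b] [c d] /=.
by rewrite oppr0 !mul0r !sub0r !mulN1r !opprK.
Qed.

End ComplexExponential.

(** * Matrix-valued holomorphic functions on projective space *)

Lemma near_neq0 (R : realType) (T : topologicalType) (f : T -> R[i]) (x : T) :
  {for x, continuous f} -> f x != 0 -> \forall y \near x, f y != 0.
Proof.
move=> cf fx; apply: (cf [set c | c != 0]); apply: open_nbhs_nbhs; split => //=.
rewrite (_ : [set c | _] = [set~ 0]).
  exact/closed_openC/accessible_closed_set1/hausdorff_accessible/norm_hausdorff.
by apply/seteqP; split=> c /= /eqP.
Qed.

Section MatrixCalculus.
Variables (R : realType) (V : normedModType R[i]).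

Lemma differentiable_mxP m n (f : V -> 'M[R[i]]_(m, n)) x :
  (forall i j, differentiable (fun y => f y i j) x) <-> differentiable f x.
Proof.
split=> [df|df i j]; last first.
  exact: (differentiable_comp df (differentiable_coord (f x) i j)).
rewrite (_ : f = \sum_(i < m) \sum_(j < n) (fun y => f y i j *: delta_mx i j)).
  apply: differentiable_sum => i; apply: differentiable_sum => j.
  exact: differentiableZl.
apply/funext => y; rewrite fct_sumE [LHS]matrix_sum_delta.
by apply: eq_bigr => i _; rewrite fct_sumE.
Qed.

Lemma differentiable_mulmx m n p (f : V -> 'M[R[i]]_(m, n))
    (g : V -> 'M[R[i]]_(n, p)) x : differentiable f x -> differentiable g x ->
  differentiable (fun y => f y *m g y) x.
Proof.
move=> /differentiable_mxP df /differentiable_mxP dg; apply/differentiable_mxP.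
move=> i j; rewrite (_ : (fun y => _) =
  \sum_(k < n) ((fun y => f y i k) * (fun y => g y k j))).
  by apply: differentiable_sum => k; exact: differentiableM.
by apply/funext => y; rewrite fct_sumE mxE.
Qed.

Lemma differentiable_scalemx m n (f : V -> R[i]) (g : V -> 'M[R[i]]_(m, n)) x :
  differentiable f x -> differentiable g x ->
  differentiable (fun y => f y *: g y) x.
Proof.
move=> df /differentiable_mxP dg; apply/differentiable_mxP => i j.
rewrite (_ : (fun y => _) = f * (fun y => g y i j)).
  exact: differentiableM.
by apply/funext => y; rewrite mxE.
Qed.

End MatrixCalculus.

Section HolomorphicFunctions.
Variables (R : realType) (n : nat).
Notation C := R[i].
Notation P := (pspace_atlas R n).

Lemma differentiable_affine_lift_mx i (z : 'rV[C]_n) :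
  differentiable (affine_lift i) z.
Proof.
apply/differentiable_mxP => a j; rewrite ord1.
exact: differentiable_affine_lift.
Qed.

Lemma hcoord_par (i : 'I_n.+1) (z : 'rV[C]_n) :
  exists2 c, c != 0 & hcoord (par P i z) = c *: affine_lift i z.
Proof. exact: hcoord_affine_lift. Qed.

Lemma differentiable_scale (V : normedModType C) (c : C) (x : V) :
  differentiable (fun y : V => c *: y) x.
Proof.
change (differentiable ( *:%R c : V -> V) x).
exact/linear_differentiable/scaler_continuous.
Qed.

(** The representative [hcoord L] is an arbitrary choice, with no regularity in L;
    homogeneity of degree 0 allows its replacement by the affine representative
    of a chart. *)
Lemma holomorphic_homog (W : normedModType C) (F : 'rV[C]_n.+1 -> W)
    (U : set P) : (forall c x, c != 0 -> F (c *: x) = F x) ->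
  (forall L : P, U L -> differentiable F (hcoord L)) ->
  holomorphic_on U (fun L : P => F (hcoord L)).
Proof.
move=> hF dF i z _ Uz.
have -> : (fun L : P => F (hcoord L)) \o par P i = F \o affine_lift i.
  apply/funext => w /=; have [c c0 ->] := hcoord_par i w; exact: hF.
apply: differentiable_comp; first exact: differentiable_affine_lift_mx.
have := dF _ Uz; have [c c0 ->] := hcoord_par i z => dFc.
have FE : F \o (fun y => c *: y) = F by apply/funext => y /=; rewrite hF.
have := differentiable_comp (differentiable_scale c (affine_lift i z)) dFc.
by rewrite FE.
Qed.

Variable rho : {posnum R}.
Notation PD := (prod_atlas P (disc_atlas rho)).

Lemma holomorphic_homog_prod (W : normedModType C) (F : 'rV[C]_n.+1 * C -> W)
    (U : set PD) :
  (forall c x t, c != 0 -> F (c *: x, t) = F (x, t)) ->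
  (forall y : PD, U y -> differentiable F (hcoord y.1, val y.2)) ->
  holomorphic_on U (fun y : PD => F (hcoord y.1, val y.2)).
Proof.
move=> hF dF [i []] [z tau] [/= _ dtau] Uz.
have dv s : dom (disc_atlas rho) tt s -> val (insubd (disc0 rho) s) = s.
  by move=> ds; rewrite insubdK.
apply: (@near_eq_differentiable _ _ _ (fun w => F (affine_lift i w.1, w.2))).
  have oD := @open_dom _ _ PD (i, tt).
  have := open_nbhs_nbhs (conj oD (conj Logic.I dtau : dom PD (i, tt) (z, tau))).
  apply: filterS => -[w s] [/= _ ds]; rewrite dv//.
  by have [c c0 ->] := hcoord_par i w; rewrite hF.
have := dF _ Uz; rewrite /= dv//.
have [c c0 ->] := hcoord_par i z => dFc.
pose g (w : 'rV[C]_n * C) := (c *: affine_lift i w.1, w.2).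
have FE : F \o g = (fun w => F (affine_lift i w.1, w.2)).
  by apply/funext => y /=; rewrite hF.
rewrite -FE; apply: (@differentiable_comp _ _ _ _ g F) => //.
apply: differentiable_pair.
  apply: (@differentiable_comp _ _ _ _ (fun w => affine_lift i w.1) (fun y => c *: y)).
    apply: (@differentiable_comp _ _ _ _ fst (affine_lift i)).
      by apply: (@linear_differentiable _ _ _ fst) => w; exact: cvg_fst.
    exact: differentiable_affine_lift_mx.
  exact: differentiable_scale.
by apply: (@linear_differentiable _ _ _ snd) => w; exact: cvg_snd.
Qed.

End HolomorphicFunctions.

Section Opens.
Variables (R : realType) (E : normedModType R[i]) (X : atlas E).

Lemma open_on_neq0 (U : set X) (f : X -> R[i]) : open_on U ->
  holomorphic_on U f -> open_on (U `&` [set x | f x != 0]).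
Proof.
move=> oU hf a; rewrite openE => z [dz [Uz fz]].
have n1 := open_nbhs_nbhs (conj (oU a) (conj dz Uz)).
have /differentiable_continuous fc := hf a z dz Uz.
have n2 := near_neq0 fc fz.
by apply: filterS2 n1 n2 => w [dw Uw] fw.
Qed.

Lemma holomorphic_onS (F : normedModType R[i]) (U W : set X) (f : X -> F) :
  U `<=` W -> holomorphic_on W f -> holomorphic_on U f.
Proof. by move=> UW hf a z dz /UW; exact: hf. Qed.

Lemma open_onI (U W : set X) : open_on U -> open_on W -> open_on (U `&` W).
Proof.
move=> oU oW a; rewrite preimage_setI setIIr.
by apply: openI; [exact: oU|exact: oW].
Qed.

Lemma holomorphic_eq_on (F : normedModType R[i]) (U : set X) (f g : X -> F) :
  open_on U -> (forall x, U x -> f x = g x) ->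
  holomorphic_on U f -> holomorphic_on U g.
Proof.
move=> oU fg hf a z dz Uz; apply: near_eq_differentiable (hf a z dz Uz).
have := open_nbhs_nbhs (conj (oU a) (conj dz Uz)).
by apply: filterS => w [dw Uw] /=; exact: fg.
Qed.

End Opens.

Lemma open_on_prod (R : realType) (E F : normedModType R[i]) (X : atlas E)
    (Y : atlas F) (U : set X) : open_on U ->
  open_on (X := prod_atlas X Y) [set y | U y.1].
Proof.
move=> oU [a b]; rewrite (_ : _ `&` _ = (dom X a `&` par X a @^-1` U) `*` dom Y b).
  by apply: openX; [exact: oU|exact: open_dom].
by apply/seteqP; split=> -[z w] [] /= [].
Qed.

Lemma open_on_hcoord (R : realType) n (i : 'I_n.+1) :
  open_on (X := pspace_atlas R n) [set L | hcoord L 0 i != 0].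
Proof.
move=> a; rewrite (_ : [set L | _] = par (pspace_atlas R n) i @` dom (pspace_atlas R n) i).
  exact: open_overlap.
by apply/seteqP; split=> L /(pimage i L).
Qed.

(** * Lines and constancy *)

(** Local definitions that agree on overlaps are glued by choice; holomorphy is
    local, so it is inherited. *)
Lemma holomorphic_glue (R : realType) (E F : normedModType R[i]) (X : atlas E)
    (I : Type) (U : I -> set X) (f : I -> X -> F) :
  (forall i, open_on (U i)) -> (forall i, holomorphic_on (U i) (f i)) ->
  (forall i j x, U i x -> U j x -> f i x = f j x) ->
  exists2 h : X -> F, forall i x, U i x -> h x = f i x &
    holomorphic_on [set x | exists i, U i x] h.
Proof.
move=> oU hf ff.
have val_ex (x : X) : exists y : F, forall i, U i x -> y = f i x.
  have [[i Ui]|nU] := pselect (exists i, U i x).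
    by exists (f i x) => j Uj; exact: ff.
  by exists 0 => i Ui; case: nU; exists i.
have [h hP] := choice val_ex.
exists h => [i x Ui|a z dz [i Ui]]; first exact: hP.
have hg : holomorphic_on (U i) h.
  by apply: holomorphic_eq_on (oU i) _ (hf i) => x Ux; rewrite (hP x i).
exact: hg.
Qed.

Section HolomorphicOps.
Variables (R : realType) (E : normedModType R[i]) (X : atlas E) (U : set X).

Lemma holomorphic_onM (f g : X -> R[i]) : holomorphic_on U f ->
  holomorphic_on U g -> holomorphic_on U (fun x => f x * g x).
Proof.
by move=> hf hg a z dz Uz; apply: differentiableM; [exact: hf|exact: hg].
Qed.

Lemma holomorphic_onB (f g : X -> R[i]) : holomorphic_on U f ->
  holomorphic_on U g -> holomorphic_on U (fun x => f x - g x).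
Proof.
by move=> hf hg a z dz Uz; apply: differentiableB; [exact: hf|exact: hg].
Qed.

Lemma holomorphic_on_mxP m n (f : X -> 'M[R[i]]_(m, n)) :
  holomorphic_on U f <-> forall i j, holomorphic_on U (fun x => f x i j).
Proof.
split=> [hf i j a z dz Uz|hf a z dz Uz].
  by have /differentiable_mxP/(_ i j) := hf a z dz Uz.
by apply/differentiable_mxP => i j; exact: hf.
Qed.

Lemma holomorphic_on_mulmx m n p (f : X -> 'M[R[i]]_(m, n))
    (g : X -> 'M[R[i]]_(n, p)) : holomorphic_on U f -> holomorphic_on U g ->
  holomorphic_on U (fun x => f x *m g x).
Proof.
by move=> hf hg a z dz Uz; apply: differentiable_mulmx; [exact: hf|exact: hg].
Qed.

End HolomorphicOps.

Section Lines.
Variables (R : realType) (n : nat).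
Notation C := R[i].
Notation P := (pspace_atlas R n).

(** The point of projective space with homogeneous coordinates [x].  The value at
    x = 0 is arbitrary; a total function avoids carrying proofs of x <> 0. *)
Definition ppoint (x : 'rV[C]_n.+1) : P := insubd (par P ord0 0) <[x]>%VS.

Lemma val_ppoint x : x != 0 -> val (ppoint x) = <[x]>%VS.
Proof. by move=> x0; rewrite /ppoint val_insubd dim_vline x0. Qed.

Lemma ppoint_affine_lift i z : ppoint (affine_lift i z) = par P i z.
Proof. by apply/val_inj; rewrite val_ppoint// affine_lift_neq0. Qed.

Lemma ppointZ c x : c != 0 -> ppoint (c *: x) = ppoint x.
Proof.
move=> c0; rewrite /ppoint; congr insubd; apply/eqP.
rewrite eqEsubv -!memvE memvZ ?memv_line//=.
by rewrite -[X in X \in _](scalerK c0) memvZ ?memv_line.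
Qed.

Lemma hcoordK (L : P) : ppoint (hcoord L) = L.
Proof.
apply/val_inj; rewrite val_ppoint ?hcoord_neq0//.
apply/eqP; rewrite eqEdim dim_vline hcoord_neq0 (eqP (valP L)) leqnn andbT.
by rewrite -memvE memv_pick.
Qed.

Lemma hcoord_ppoint x : x != 0 -> exists2 c, c != 0 & hcoord (ppoint x) = c *: x.
Proof.
move=> x0; have : hcoord (ppoint x) \in <[x]>%VS.
  by rewrite -val_ppoint// memv_pick.
move=> /vlineP[c cE]; exists c => //.
by apply/eqP => c0; have := hcoord_neq0 (ppoint x); rewrite cE c0 scale0r eqxx.
Qed.

Definition affine_coord (i : 'I_n.+1) (x : 'rV[C]_n.+1) : 'rV[C]_n :=
  \row_k (x 0 (lift i k) / x 0 i).

Lemma affine_coordK i (x : 'rV[C]_n.+1) : x 0 i != 0 ->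
  affine_lift i (affine_coord i x) = (x 0 i)^-1 *: x.
Proof.
move=> xi; apply/rowP => j; rewrite !mxE; case: unliftP => [k ->|->] /=.
  by rewrite mxE mulrC.
by rewrite mulVf.
Qed.

Lemma ppoint_affine_coord i (x : 'rV[C]_n.+1) : x 0 i != 0 ->
  ppoint x = par P i (affine_coord i x).
Proof.
by move=> xi; rewrite -ppoint_affine_lift affine_coordK// ppointZ// invr_eq0.
Qed.

Lemma differentiable_affine_coord i (x : 'rV[C]_n.+1) : x 0 i != 0 ->
  differentiable (affine_coord i) x.
Proof.
move=> xi; apply/differentiable_mxP => a k; rewrite ord1.
rewrite (_ : (fun y => _) = (fun y : 'rV[C]_n.+1 => y 0 (lift i k)) *
  (fun y => (y 0 i)^-1)); last by apply/funext => y; rewrite !mxE.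
apply: differentiableM; first exact: differentiable_coord.
by apply: differentiableV => //; exact: differentiable_coord.
Qed.

Lemma differentiable_ppoint (W : set P) (h : P -> C) (x : 'rV[C]_n.+1) :
  holomorphic_on W h -> x != 0 -> W (ppoint x) -> differentiable (h \o ppoint) x.
Proof.
move=> hh /rV0Pn[i xi] Wx.
apply: (@near_eq_differentiable _ _ _ (h \o par P i \o affine_coord i)).
  have ci := differentiable_continuous (@differentiable_coord _ _ _ x 0 i).
  by apply: filterS (near_neq0 ci xi) => y /= yi; rewrite (ppoint_affine_coord yi).
apply: differentiable_comp; first exact: differentiable_affine_coord.
by apply: hh => //; rewrite -(ppoint_affine_coord xi).
Qed.

(** The line is parametrized by u + z v and v + z u, which are its two standard
    affine charts. *)
Lemma line_const (W : set P) (h : P -> C) (u v : 'rV[C]_n.+1) :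
  holomorphic_on W h ->
  (forall a b, (a != 0) || (b != 0) ->
    a *: u + b *: v != 0 /\ W (ppoint (a *: u + b *: v))) ->
  h (ppoint u) = h (ppoint v).
Proof.
move=> hh uv.
pose g (u v : 'rV[C]_n.+1) (z : C) := h (ppoint (u + z *: v)).
have daff (p q : 'rV[C]_n.+1) z : differentiable (fun z : C => p + z *: q) z.
  apply: differentiableD; first exact: differentiable_cst.
  apply: (@differentiable_scalemx _ _ _ _ id (cst q)) => //.
have dg1 z : differentiable (g u v) z.
  have [] := uv 1 z; first by rewrite oner_eq0.
  rewrite scale1r => n0 Wz.
  have H := differentiable_comp (daff u v z) (differentiable_ppoint hh n0 Wz).
  exact: H.
have dg2 z : differentiable (g v u) z.
  have [] := uv z 1; first by rewrite oner_eq0 orbT.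
  rewrite scale1r addrC => n0 Wz.
  have H := differentiable_comp (daff v u z) (differentiable_ppoint hh n0 Wz).
  exact: H.
have := entire_two_charts dg1 dg2; rewrite /g !scale0r !addr0; apply.
move=> z z0; rewrite -(ppointZ (u + z *: v) (invr_neq0 z0)).
by rewrite scalerDr scalerA mulVf// scale1r addrC.
Qed.

Lemma holomorphic_const (h : P -> C) (L L' : P) :
  holomorphic_on setT h -> h L = h L'.
Proof.
move=> hh; rewrite -(hcoordK L) -(hcoordK L').
set u := hcoord L; set v := hcoord L'.
have u0 : u != 0 by exact: hcoord_neq0.
have v0 : v != 0 by exact: hcoord_neq0.
have [[c uE]|ind] := pselect (exists c, u = c *: v).
  rewrite uE ppointZ//; apply/eqP => c0.
  by move: u0; rewrite uE c0 scale0r eqxx.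
apply: line_const hh _ => a b ab; split=> //; apply/eqP => E.
have [a0|a0] := eqVneq a 0.
  move: ab E; rewrite a0 eqxx /= scale0r add0r => b0 /eqP.
  by rewrite scaler_eq0 (negPf b0) (negPf v0).
apply: ind; exists (- b / a); apply: (scalerI a0).
by rewrite scalerA mulrC divfK// scaleNr; apply/eqP; rewrite -addr_eq0 E.
Qed.

End Lines.

Section Wedge.
Variables (R : realType) (n : nat).
Notation C := R[i].
Notation P := (pspace_atlas R n).

(** The bivector of u and v, as a skew-symmetric matrix. *)
Definition wedge (u v : 'rV[C]_n.+1) : 'M[C]_n.+1 := u^T *m v - v^T *m u.

Lemma wedgeE u v i j : wedge u v i j = u 0 i * v 0 j - v 0 i * u 0 j.
Proof. by rewrite !mxE !big_ord1 !mxE. Qed.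

Lemma wedge_addZ u v g : wedge (u + g *: v) v = wedge u v.
Proof. by apply/matrixP => i j; rewrite !wedgeE !mxE; ring. Qed.

Variables (A : 'M[C]_n.+1) (I : Type) (U : I -> set P) (e : I -> 'I_n.+1).
Variable (psi : I -> P -> 'rV[C]_n.+1).
Hypothesis oU : forall i, open_on (U i).
Hypothesis Ucov : forall L, exists i, U i L.
Hypothesis Ue : forall i L, U i L -> hcoord L 0 (e i) != 0.
Hypothesis hpsi : forall i,
  holomorphic_on (U i) (fun L => hcoord L 0 (e i) *: psi i L).
Hypothesis psi_glue : forall i j L, U i L -> U j L ->
  exists g, psi i L = psi j L + g *: (hcoord L *m A).

(** The vectors [psi i L] are homogeneous of degree -1 and glue modulo the linear
    vector x A, so their bivectors with x A glue to a global function of degree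
    0. *)
Lemma wedge_const : exists c : 'M[C]_n.+1, forall i L, U i L ->
  wedge (psi i L) (hcoord L *m A) = c.
Proof.
have holoA i k : holomorphic_on (U i)
    (fun L => (hcoord L *m A) 0 k / hcoord L 0 (e i)).
  apply: (@holomorphic_homog _ _ _ (fun x => (x *m A) 0 k / x 0 (e i))).
    by move=> c x c0; rewrite -scalemxAl !mxE -mulf_div divff// mul1r.
  move=> L /Ue Le; apply: (@differentiableM _ _ (fun x => (x *m A) 0 k)
    (fun x => (x 0 (e i))^-1)).
    have : differentiable (fun x : 'rV[C]_n.+1 => x *m A) (hcoord L).
      apply: (@differentiable_mulmx _ _ _ _ _ id (cst A)) => //.
    by move=> /differentiable_mxP/(_ 0 k).
  by apply: differentiableV => //; exact: differentiable_coord.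
have [h hE hh] : exists2 h : P -> 'M[C]_n.+1, forall i L, U i L ->
    h L = wedge (psi i L) (hcoord L *m A) &
    holomorphic_on [set x | exists i, U i x] h.
  apply: (@holomorphic_glue _ _ _ P _ U
      (fun i L => wedge (psi i L) (hcoord L *m A)) oU).
    move=> i; apply/holomorphic_on_mxP => k l.
    have hp (k' : 'I_n.+1) : holomorphic_on (U i) (fun L => hcoord L 0 (e i) * psi i L 0 k').
      have /holomorphic_on_mxP/(_ 0 k') := @hpsi i.
      by under eq_fun do rewrite mxE.
    have H := holomorphic_onB (holomorphic_onM (hp k) (holoA i l))
      (holomorphic_onM (holoA i k) (hp l)).
    apply: holomorphic_eq_on (@oU i) _ H.
    by move=> L /Ue Le; rewrite wedgeE; field.
  move=> i j L Ui Uj; have [g ->] := psi_glue Ui Uj; exact: wedge_addZ.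
pose L0 := par P ord0 0; exists (h L0) => i L Ui; rewrite -(hE i)//.
apply/matrixP => k l; apply: (@holomorphic_const _ _ (fun L => h L k l)).
have /holomorphic_on_mxP/(_ k l) := hh.
by apply: holomorphic_onS => L' _; exact: Ucov.
Qed.

End Wedge.

(** * Linear algebra of the monad *)

Lemma sumr_deltar (F : pzRingType) (I : finType) (f : I -> F) a :
  \sum_i f i * (i == a)%:R = f a.
Proof.
rewrite (bigD1 a)//= eqxx mulr1 big1 ?addr0// => i /negPf ->.
by rewrite mulr0.
Qed.

Lemma sumr_deltal (F : pzRingType) (I : finType) (f : I -> F) a :
  \sum_i (i == a)%:R * f i = f a.
Proof.
rewrite (bigD1 a)//= eqxx mul1r big1 ?addr0// => i /negPf ->.
by rewrite mul0r.
Qed.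

Section QuotientFrame.
Variables (F : fieldType) (n : nat).
Implicit Types (p : 'I_n.+1) (al : 'rV[F]_n.+1).

Definition lift_mx p : 'M[F]_(n, n.+1) := \matrix_(k, i) (i == lift p k)%:R.

(** The quotient of F^(n+1) by a vector [al] with nonzero entry at p has as
    coordinates the entries k <> p, after the entry p has been cleared by means
    of [al]; [lift_mx] is the section with entry 0 at p. *)
Definition quot_mx p al : 'M[F]_(n.+1, n) :=
  \matrix_(i, k) ((i == lift p k)%:R - (i == p)%:R * (al 0 (lift p k) / al 0 p)).

Lemma lift_quot p al : lift_mx p *m quot_mx p al = 1%:M.
Proof.
apply/matrixP => k l; rewrite !mxE.
under eq_bigr do rewrite !mxE.
by rewrite sumr_deltal [_ == p]eq_sym (negPf (neq_lift _ _)) mul0r subr0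
  (inj_eq lift_inj).
Qed.

Lemma quot_vec p al : al 0 p != 0 -> al *m quot_mx p al = 0.
Proof.
move=> alp; apply/rowP => k; rewrite !mxE.
under eq_bigr do rewrite !mxE mulrBr (mulrA (al 0 _)).
by rewrite sumrB -mulr_suml !sumr_deltar mulrCA divff// mulr1 subrr.
Qed.

Lemma quot_lift m p al (V : 'M[F]_(m, n.+1)) : al 0 p != 0 ->
  V *m quot_mx p al *m lift_mx p = V - ((al 0 p)^-1 *: col p V) *m al.
Proof.
move=> alp; rewrite -mulmxA; have -> : quot_mx p al *m lift_mx p =
    1%:M - (delta_mx p 0 : 'cV_n.+1) *m ((al 0 p)^-1 *: al).
  apply/matrixP => i j; rewrite !mxE big_ord1 !mxE andbT.
  case: (unliftP p j) => [l ->|->].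
    under eq_bigr do rewrite !mxE (inj_eq lift_inj) [l == _]eq_sym.
    by rewrite sumr_deltar [al 0 _ / _]mulrC.
  under eq_bigr do rewrite !mxE (negPf (neq_lift _ _)) mulr0.
  by rewrite big1// mulVf// mulr1 subrr.
by rewrite mulmxBr mulmx1 mulmxA -colE -scalemxAr -scalemxAl.
Qed.

Lemma quot_mxZ p al c : c != 0 -> quot_mx p (c *: al) = quot_mx p al.
Proof.
by move=> c0; apply/matrixP => i k; rewrite !mxE -mulf_div divff// mul1r.
Qed.

End QuotientFrame.

Section Monad.
Variables (F : numFieldType) (n : nat).
Implicit Types (p q : 'I_n.+1) (x : 'rV[F]_n.+1) (t : F).

Definition skew_mx : 'M[F]_n.+1 :=
  \matrix_(i, j) ((i == j.+1 :> nat)%:R - (j == i.+1 :> nat)%:R).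

Definition monad_mx t : 'M[F]_n.+1 := skew_mx - t *: delta_mx ord0 ord0.

Lemma monad_mx0 : monad_mx 0 = skew_mx.
Proof. by rewrite /monad_mx scale0r subr0. Qed.

(** Entries beyond the last one are 0, as the last column of [skew_mx] requires. *)
Definition entry x (k : nat) : F := oapp (x 0) 0 (insub k).

Lemma entryE x (i : 'I_n.+1) : entry x i = x 0 i.
Proof. by rewrite /entry valK. Qed.

Lemma entry_big x k : (n < k)%N -> entry x k = 0.
Proof. by move=> nk; rewrite /entry insubF// ltnS leqNgt nk. Qed.

Lemma entry_sum x k : \sum_(i < n.+1) x 0 i * (i == k :> nat)%:R = entry x k.
Proof.
have [kn|nk] := ltnP k n.+1.
  have -> : k = Ordinal kn by [].
  under eq_bigr => i _ do rewrite -[(i == _ :> nat)]/(i == Ordinal kn).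
  by rewrite sumr_deltar entryE.
rewrite entry_big// big1// => i _; case: eqP => [ik|]; last by rewrite mulr0.
by have := ltn_ord i; rewrite ik ltnNge nk.
Qed.

Lemma skewE x (j : 'I_n.+1) :
  (x *m skew_mx) 0 j = entry x j.+1 - (if (0 < j)%N then entry x j.-1 else 0).
Proof.
rewrite mxE; under eq_bigr do rewrite mxE mulrBr.
rewrite sumrB entry_sum; congr (_ - _).
case: posnP => j0.
  by rewrite big1// => i _; rewrite j0 mulr0.
rewrite -entry_sum; apply: eq_bigr => i _; congr (_ * _%:R).
by rewrite eq_sym -{1}(prednK j0) eqSS.
Qed.

Lemma skew_tr : skew_mx^T = - skew_mx.
Proof. by apply/matrixP => i j; rewrite !mxE opprB. Qed.

(** The scalar equals its transpose, which is its opposite. *)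
Lemma skew_alt x : x *m skew_mx *m x^T = 0.
Proof.
set z := _ *m _; have : z^T = - z.
  by rewrite /z !trmx_mul trmxK skew_tr mulNmx mulmxN mulmxA.
move=> /matrixP zN; apply/matrixP => i j; have := zN i j.
rewrite !ord1 !mxE => /eqP; rewrite -addr_eq0 -mulr2n mulrn_eq0 /=.
by move=> /eqP.
Qed.

Lemma monad_comp x t : x *m monad_mx t *m x^T = - (t * x 0 0 ^+ 2)%:M.
Proof.
rewrite /monad_mx mulmxBr mulmxBl skew_alt sub0r; congr (- _).
rewrite -scalemxAr -scalemxAl -(mul_delta_mx (0 : 'I_1)) mulmxA -colE.
rewrite -mulmxA -rowE; apply/matrixP => i j.
by rewrite !ord1 !mxE big_ord1 !mxE mulr1n expr2.
Qed.

Lemma monadE x t (j : 'I_n.+1) : (x *m monad_mx t) 0 j =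
  entry x j.+1 - (if (0 < j)%N then entry x j.-1 else t * x 0 0).
Proof.
have mxBE (M N : 'rV[F]_n.+1) : (M - t *: N) 0 j = M 0 j - t * N 0 j.
  by rewrite !mxE.
rewrite /monad_mx mulmxBr -scalemxAr mxBE skewE.
rewrite -(mul_delta_mx (0 : 'I_1)) mulmxA -colE mxE big_ord1 !mxE.
have [j0|j0] := posnP j; last first.
  by rewrite (_ : (j == ord0) = false) ?andbF ?mulr0 ?subr0// -val_eqE gtn_eqF.
have -> : j = ord0 by exact: val_inj.
by rewrite eqxx mulr1 subr0.
Qed.

(** The columns of the equation read x_1 = t x_0 and x_(k+2) = x_k, so x vanishes
    with its first entry. *)
Lemma monad_inj0 x t : x *m monad_mx t = 0 -> x 0 0 = 0 -> x = 0.
Proof.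
move=> xA x0; have step k : (k.+1 < n.+1)%N -> entry x k = 0 -> entry x k.+2 = 0.
  move=> kn xk; have := congr1 (fun v : 'rV_n.+1 => v 0 (Ordinal kn)) xA.
  by rewrite monadE /= xk subr0 mxE.
have y0 : entry x 0 = 0 by rewrite (entryE x 0).
have y1 : entry x 1 = 0.
  have := congr1 (fun v : 'rV_n.+1 => v 0 0) xA.
  by rewrite monadE /= x0 mulr0 subr0 mxE.
have all k : entry x k = 0 /\ entry x k.+1 = 0.
  elim: k => [|k [IH1 IH2]]; split=> //.
  have [kn|nk] := ltnP k.+1 n.+1; first exact: (step k).
  by apply: entry_big; apply: leq_trans nk _.
by apply/rowP => j; rewrite mxE -entryE; have [] := all j.
Qed.

(** The last column gives x_(n-1) = 0, and x_(k+2) = x_k carries this down to x_0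
    for odd n and to x_1 = t x_0 for even n. *)
Lemma monad_inj x t : (0 < n)%N -> t != 0 -> x *m monad_mx t = 0 -> x = 0.
Proof.
move=> n0 t0 xA; apply: (monad_inj0 xA).
have step k : (k.+1 < n.+1)%N -> entry x k = entry x k.+2.
  move=> kn; have := congr1 (fun v : 'rV_n.+1 => v 0 (Ordinal kn)) xA.
  by rewrite monadE /= mxE => /eqP; rewrite subr_eq0 => /eqP.
have back i k : (k + i.*2)%N = n.+1 -> entry x k = 0.
  elim: i k => [|i IH] k.
    by rewrite addn0 => ->; rewrite entry_big.
  rewrite doubleS !addnS => E; rewrite step; last by rewrite -E; lia.
  by apply: IH; rewrite -E; lia.
have y1 : entry x 1 = t * x 0 0.
  have := congr1 (fun v : 'rV_n.+1 => v 0 0) xA.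
  by rewrite monadE /= mxE => /eqP; rewrite subr_eq0 => /eqP.
have [on|en] := boolP (odd n).
  rewrite -[x 0 0]entryE; apply: (back (n.+1./2)).
  by rewrite add0n; have := odd_double_half n.+1; rewrite /= on.
have := back (n./2) 1%N; rewrite y1 add1n.
have := odd_double_half n; rewrite (negPf en) add0n => -> /(_ erefl) /eqP.
by rewrite mulf_eq0 (negPf t0) => /eqP.
Qed.

(** Where x_q <> 0, the equation b = 0 determines the entry q of the component in
    O(1)^(n+1).  Coordinates on the kernel are the other entries, and the
    component in O(2) takes the free place q.  All are divided by powers of x_q
    to have degree 0.  The suffixes 1 and 2 refer to O(1)^(n+1) and O(2); the
    matrices [ker_lift1], [ker_lift2] invert these coordinates. *)
Definition ker_proj1 q x : 'M[F]_n.+1 := (x 0 q)^-1 *: (1%:M - delta_mx q q).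
Definition ker_proj2 q x : 'rV[F]_n.+1 := (x 0 q) ^- 2 *: delta_mx 0 q.
Definition ker_lift1 q x t : 'M[F]_n.+1 := \matrix_(k, l)
  if l == q then - (if k == q then x 0 q * t else x 0 k) else x 0 q * (k == l)%:R.
Definition ker_lift2 q x : 'cV[F]_n.+1 := x 0 q ^+ 2 *: delta_mx q 0.

Lemma ker_projE q x m (V1 : 'M[F]_(m, n.+1)) (V2 : 'cV[F]_m) r k :
  (V1 *m ker_proj1 q x + V2 *m ker_proj2 q x) r k =
    if k == q then V2 r 0 / x 0 q ^+ 2 else V1 r k / x 0 q.
Proof.
rewrite /ker_proj1 /ker_proj2 -!scalemxAr mulmxBr mulmx1.
rewrite -(mul_delta_mx (0 : 'I_1)) mulmxA -colE !mxE !big_ord1 !mxE.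
rewrite !eqxx /=; case: eqVneq => [->|kq] /=.
  by rewrite !mulr1 subrr mulr0 add0r mulrC.
by rewrite !mulr0 subr0 addr0 mulrC.
Qed.

Lemma ker_lift_proj q x t : x 0 q != 0 ->
  ker_lift1 q x t *m ker_proj1 q x + ker_lift2 q x *m ker_proj2 q x = 1%:M.
Proof.
move=> xq; apply/matrixP => k l; rewrite ker_projE !mxE andbT.
case: (eqVneq l q) => [->|lq].
  by rewrite mulrC mulKf// expf_neq0.
by rewrite mulrC mulKf.
Qed.

Lemma ker_lift_comp q x t :
  ker_lift1 q x t *m x^T + t *: ker_lift2 q x = 0.
Proof.
apply/colP => k; rewrite !mxE andbT (bigD1 q)//= !mxE eqxx.
rewrite (eq_bigr (fun l => x 0 q * ((l == k)%:R * x 0 l))); last first.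
  by move=> l lq; rewrite !mxE (negPf lq) mulrA eq_sym.
have [->|kq] := eqVneq k q.
  rewrite big1; last by move=> l /negPf ->; rewrite mul0r mulr0.
  by rewrite mulr1; ring.
rewrite -mulr_sumr (bigD1 k)//= eqxx big1; last first.
  by move=> l /andP[_ /negPf ->]; rewrite mul0r.
by rewrite mulr1n; ring.
Qed.

Lemma ker_proj_lift q x t m (V1 : 'M[F]_(m, n.+1)) (V2 : 'cV[F]_m) :
  x 0 q != 0 -> V1 *m x^T + t *: V2 = 0 ->
  (V1 *m ker_proj1 q x + V2 *m ker_proj2 q x) *m ker_lift1 q x t = V1 /\
  (V1 *m ker_proj1 q x + V2 *m ker_proj2 q x) *m ker_lift2 q x = V2.
Proof.
move=> xq ker; have := ker_projE q x V1 V2.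
move: (_ + _) => be beE; split; last first.
  rewrite -scalemxAr -colE; apply/colP => r.
  by rewrite !mxE beE eqxx mulrC divfK// expf_neq0.
apply/matrixP => r l; rewrite mxE.
under eq_bigr => k _ do rewrite [ker_lift1 _ _ _ _ _]mxE beE.
have [->|lq] := eqVneq l q; last first.
  rewrite (eq_bigr (fun k => x 0 q * be r k * (k == l)%:R)); last first.
    by move=> k _; rewrite beE; ring.
  by rewrite sumr_deltar beE (negPf lq) mulrC divfK.
have := congr1 (fun M : 'cV_m => M r 0) ker.
rewrite !mxE (bigD1 q)//= mxE => E; rewrite (bigD1 q)//= !eqxx.
rewrite (eq_bigr (fun k => - (x 0 q)^-1 * (V1 r k * x^T k 0))); last first.
  by move=> k /negPf kq; rewrite kq mxE; ring.
rewrite -mulr_sumr; move: E; set S := \sum_(_ < _ | _) _ => E.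
have -> : S = (V1 r q * x 0 q + S + t * V2 r 0) - (V1 r q * x 0 q + t * V2 r 0).
  by ring.
rewrite E.
by field.
Qed.

End Monad.

Section Frame.
Variables (F : numFieldType) (n : nat).
Implicit Types (v w : 'I_n.+1 * 'I_n.+1) (x : 'rV[F]_n.+1) (t c : F).

(** The two components of the map a. *)
Definition sub1 x t : 'rV[F]_n.+1 := x *m monad_mx n t.
Definition sub2 x : 'M[F]_1 := (x 0 0 ^+ 2)%:M.
Definition sub_coord (q : 'I_n.+1) x t : 'rV[F]_n.+1 :=
  sub1 x t *m ker_proj1 q x + sub2 x *m ker_proj2 q x.

(** A trivialization is given by v = (q, p): the kernel of b is trivialized where
    x_q <> 0, and its quotient by a is trivialized where the coordinate p of a is
    nonzero.  A frame lifts the fibre to the kernel of b, and a coframe gives the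
    coordinates of an element of the kernel. *)
Definition frame1 v x t : 'M[F]_(n, n.+1) := lift_mx F v.2 *m ker_lift1 v.1 x t.
Definition frame2 v x : 'cV[F]_n := lift_mx F v.2 *m ker_lift2 v.1 x.
Definition coframe1 v x t : 'M[F]_(n.+1, n) :=
  ker_proj1 v.1 x *m quot_mx v.2 (sub_coord v.1 x t).
Definition coframe2 v x t : 'rV[F]_n :=
  ker_proj2 v.1 x *m quot_mx v.2 (sub_coord v.1 x t).

Definition frame_dom v x t :=
  (x 0 v.1 != 0) && (sub_coord v.1 x t 0 v.2 != 0).

Lemma sub_comp x t : sub1 x t *m x^T + t *: sub2 x = 0.
Proof. by rewrite /sub1 monad_comp /sub2 scale_scalar_mx addNr. Qed.

Lemma sub_neq0 x t : x != 0 -> sub1 x t = 0 -> sub2 x = 0 -> False.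
Proof.
move=> x0 s1 /matrixP/(_ 0 0); rewrite !mxE mulr1n => /eqP.
rewrite expf_eq0 /= => /eqP x00.
by move/eqP: x0; apply; exact: (monad_inj0 s1 x00).
Qed.

(** Coordinates on the kernel are faithful and a does not vanish, so some
    coordinate of a is nonzero. *)
Lemma frame_dom_cover x t : x != 0 -> exists v, frame_dom v x t.
Proof.
move=> x0; have /rV0Pn[q xq] := x0.
have [E1 E2] := ker_proj_lift xq (sub_comp x t).
have /rV0Pn[p alp] : sub_coord q x t != 0.
  apply/eqP => al0; move: E1 E2; rewrite -/(sub_coord q x t) al0 !mul0mx.
  by move=> E1 E2; exact: (sub_neq0 x0 (esym E1) (esym E2)).
by exists (q, p); rewrite /frame_dom /= xq.
Qed.

Lemma frame_comp v x t : frame1 v x t *m x^T + t *: frame2 v x = 0.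
Proof.
by rewrite -mulmxA scalemxAr -mulmxDr ker_lift_comp mulmx0.
Qed.

Definition frame_trans v w x t : 'M[F]_n :=
  frame1 v x t *m coframe1 w x t + frame2 v x *m coframe2 w x t.

Lemma frame_transE m v x t (V1 : 'M[F]_(m, n.+1)) (V2 : 'cV[F]_m) :
  V1 *m coframe1 v x t + V2 *m coframe2 v x t =
  (V1 *m ker_proj1 v.1 x + V2 *m ker_proj2 v.1 x) *m
    quot_mx v.2 (sub_coord v.1 x t).
Proof. by rewrite mulmxDl -!mulmxA. Qed.

Lemma frame_trans_id v x t : frame_dom v x t -> frame_trans v v x t = 1%:M.
Proof.
move=> /andP[xq alp]; rewrite /frame_trans frame_transE -!mulmxA -mulmxDr.
by rewrite ker_lift_proj// mulmx1 lift_quot.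
Qed.

Lemma sub_coframe v x t : frame_dom v x t ->
  sub1 x t *m coframe1 v x t + sub2 x *m coframe2 v x t = 0.
Proof. by move=> /andP[xq alp]; rewrite frame_transE quot_vec. Qed.

(** Passing to coordinates and lifting back changes an element of the kernel of b
    by a multiple of a only; this is all that the cocycle relations need. *)
Lemma coframe_frame m v x t (V1 : 'M[F]_(m, n.+1)) (V2 : 'cV[F]_m) :
  frame_dom v x t -> V1 *m x^T + t *: V2 = 0 ->
  exists k : 'cV[F]_m,
    (V1 *m coframe1 v x t + V2 *m coframe2 v x t) *m frame1 v x t =
      V1 - k *m sub1 x t /\
    (V1 *m coframe1 v x t + V2 *m coframe2 v x t) *m frame2 v x =
      V2 - k *m sub2 x.
Proof.
move=> /andP[xq alp] ker; rewrite frame_transE.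
set be := _ + _; exists ((sub_coord v.1 x t 0 v.2)^-1 *: col v.2 be).
have [E1 E2] := ker_proj_lift xq ker.
have [A1 A2] := ker_proj_lift xq (sub_comp x t).
rewrite !mulmxA quot_lift// !mulmxBl -!mulmxA.
by rewrite [be *m ker_lift1 _ _ _]E1 [be *m ker_lift2 _ _]E2 A1 A2.
Qed.

Lemma frame_trans_frame u v x t : frame_dom v x t ->
  exists k : 'cV[F]_n,
    frame_trans u v x t *m frame1 v x t = frame1 u x t - k *m sub1 x t /\
    frame_trans u v x t *m frame2 v x = frame2 u x - k *m sub2 x.
Proof. by move=> dv; exact: coframe_frame dv (frame_comp u x t). Qed.

Lemma frame_trans_mul u v w x t : frame_dom v x t -> frame_dom w x t ->
  frame_trans u v x t *m frame_trans v w x t = frame_trans u w x t.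
Proof.
move=> dv dw; have [k [E1 E2]] := frame_trans_frame u dv.
rewrite {2}/frame_trans mulmxDr (mulmxA _ (frame1 v x t)) E1.
rewrite (mulmxA _ (frame2 v x)) E2 !mulmxBl addrACA -opprD.
by rewrite -!(mulmxA k) -mulmxDr sub_coframe// mulmx0 subr0.
Qed.

Lemma mulmxZZ (a : F) m p r (A : 'M[F]_(m, p)) (B : 'M[F]_(p, r)) : a != 0 ->
  (a *: A) *m (a^-1 *: B) = A *m B.
Proof. by move=> a0; rewrite -scalemxAl -scalemxAr scalerA divff// scale1r. Qed.

Lemma sub1Z c x t : sub1 (c *: x) t = c *: sub1 x t.
Proof. by rewrite /sub1 scalemxAl. Qed.

Lemma sub2Z c x : sub2 (c *: x) = c ^+ 2 *: sub2 x.
Proof. by rewrite /sub2 mxE exprMn scale_scalar_mx. Qed.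

Lemma ker_proj1Z c q x : ker_proj1 q (c *: x) = c^-1 *: ker_proj1 q x.
Proof. by rewrite /ker_proj1 mxE invfM scalerA. Qed.

Lemma ker_proj2Z c q x : ker_proj2 q (c *: x) = c ^- 2 *: ker_proj2 q x.
Proof. by rewrite /ker_proj2 mxE exprMn invfM scalerA. Qed.

Lemma sub_coordZ c q x t : c != 0 -> sub_coord q (c *: x) t = sub_coord q x t.
Proof.
move=> c0; rewrite /sub_coord sub1Z sub2Z ker_proj1Z ker_proj2Z.
by rewrite !mulmxZZ// expf_neq0.
Qed.

Lemma frame1Z c v x t : frame1 v (c *: x) t = c *: frame1 v x t.
Proof.
rewrite /frame1 scalemxAr; congr (_ *m _).
by apply/matrixP => k l; rewrite !mxE; case: (l == _); [case: (k == _)|]; ring.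
Qed.

Lemma frame2Z c v x : frame2 v (c *: x) = c ^+ 2 *: frame2 v x.
Proof.
rewrite /frame2 scalemxAr /ker_lift2 scalerA -exprMn; congr (_ *m (_ ^+ 2 *: _)).
by rewrite mxE.
Qed.

Lemma coframe1Z c v x t : c != 0 ->
  coframe1 v (c *: x) t = c^-1 *: coframe1 v x t.
Proof. by move=> c0; rewrite /coframe1 ker_proj1Z sub_coordZ// scalemxAl. Qed.

Lemma coframe2Z c v x t : c != 0 ->
  coframe2 v (c *: x) t = c ^- 2 *: coframe2 v x t.
Proof. by move=> c0; rewrite /coframe2 ker_proj2Z sub_coordZ// scalemxAl. Qed.

Lemma frame_transZ c v w x t : c != 0 ->
  frame_trans v w (c *: x) t = frame_trans v w x t.
Proof.
move=> c0; rewrite /frame_trans frame1Z frame2Z coframe1Z// coframe2Z//.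
by rewrite !mulmxZZ// expf_neq0.
Qed.

End Frame.

(** * The degeneration *)

Section FrameHolo.
Variables (R : realType) (n : nat).
Notation C := R[i].
Notation V := ('rV[C]_n.+1 * C)%type.

Lemma differentiable_fst1 (y : V) : differentiable (fun y : V => y.1) y.
Proof. by apply: (@linear_differentiable _ _ _ fst) => w; exact: cvg_fst. Qed.

Lemma differentiable_snd1 (y : V) : differentiable (fun y : V => y.2) y.
Proof. by apply: (@linear_differentiable _ _ _ snd) => w; exact: cvg_snd. Qed.

Lemma differentiable_entry k (y : V) : differentiable (fun y : V => y.1 0 k) y.
Proof. by have /differentiable_mxP/(_ 0 k) := differentiable_fst1 y. Qed.

Lemma differentiable_const (W : normedModType C) (a : W) (y : V) :
  differentiable (fun _ : V => a) y.
Proof. exact: differentiable_cst. Qed.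

Lemma differentiable_exprn (f : V -> C) k y : differentiable f y ->
  differentiable (fun y => f y ^+ k) y.
Proof.
move=> df; elim: k => [|k IH].
  by under eq_fun do rewrite expr0; exact: differentiable_const.
by under eq_fun do rewrite exprS; exact: differentiableM df IH.
Qed.

Lemma differentiable_inv (f : V -> C) y : differentiable f y -> f y != 0 ->
  differentiable (fun y => (f y)^-1) y.
Proof. by move=> df fy; exact: differentiableV. Qed.

Lemma differentiable_sub1 y : differentiable (fun y : V => sub1 y.1 y.2) y.
Proof.
apply: differentiable_mulmx; first exact: differentiable_fst1.
rewrite /monad_mx; apply: differentiableB; first exact: differentiable_const.
apply: differentiable_scalemx; first exact: differentiable_snd1.
exact: differentiable_const.
Qed.

Lemma differentiable_sub2 y : differentiable (fun y : V => sub2 y.1) y.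
Proof.
under eq_fun do rewrite /sub2 -scalemx1.
apply: differentiable_scalemx; last exact: differentiable_const.
by apply: differentiable_exprn; exact: differentiable_entry.
Qed.

Lemma differentiable_ker_proj1 q (y : V) : y.1 0 q != 0 ->
  differentiable (fun y : V => ker_proj1 q y.1) y.
Proof.
move=> yq; apply: differentiable_scalemx; last exact: differentiable_const.
by apply: differentiable_inv => //; exact: differentiable_entry.
Qed.

Lemma differentiable_ker_proj2 q (y : V) : y.1 0 q != 0 ->
  differentiable (fun y : V => ker_proj2 q y.1) y.
Proof.
move=> yq; apply: differentiable_scalemx; last exact: differentiable_const.
apply: differentiable_inv; last by rewrite expf_neq0.
by apply: differentiable_exprn; exact: differentiable_entry.
Qed.

Lemma differentiable_sub_coord q (y : V) : y.1 0 q != 0 ->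
  differentiable (fun y : V => sub_coord q y.1 y.2) y.
Proof.
move=> yq; apply: differentiableD; apply: differentiable_mulmx.
- exact: differentiable_sub1.
- exact: differentiable_ker_proj1.
- exact: differentiable_sub2.
- exact: differentiable_ker_proj2.
Qed.

Lemma differentiable_quot_mx p (f : V -> 'rV[C]_n.+1) y : differentiable f y ->
  f y 0 p != 0 -> differentiable (fun y => quot_mx p (f y)) y.
Proof.
move=> /differentiable_mxP df fp; apply/differentiable_mxP => i k.
under eq_fun do rewrite mxE.
apply: differentiableB; first exact: differentiable_const.
apply: differentiableM; first exact: differentiable_const.
by apply: differentiableM; [exact: df|exact: differentiable_inv].
Qed.

Lemma differentiable_frame1 v y :
  differentiable (fun y : V => frame1 v y.1 y.2) y.
Proof.
apply: differentiable_mulmx; first exact: differentiable_const.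
apply/differentiable_mxP => k l; under eq_fun do rewrite mxE.
case: (l == _); [case: (k == _)|].
- apply: differentiableN; apply: differentiableM.
    exact: differentiable_entry.
  exact: differentiable_snd1.
- by apply: differentiableN; exact: differentiable_entry.
- apply: differentiableM; last exact: differentiable_const.
  exact: differentiable_entry.
Qed.

Lemma differentiable_frame2 v y : differentiable (fun y : V => frame2 v y.1) y.
Proof.
apply: differentiable_mulmx; first exact: differentiable_const.
apply: differentiable_scalemx; last exact: differentiable_const.
by apply: differentiable_exprn; exact: differentiable_entry.
Qed.

Lemma differentiable_coframe1 v (y : V) : frame_dom v y.1 y.2 ->
  differentiable (fun y : V => coframe1 v y.1 y.2) y.
Proof.
move=> /andP[yq yp]; apply: differentiable_mulmx.
  exact: differentiable_ker_proj1.
by have := differentiable_quot_mx (differentiable_sub_coord yq) yp; apply.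
Qed.

Lemma differentiable_coframe2 v (y : V) : frame_dom v y.1 y.2 ->
  differentiable (fun y : V => coframe2 v y.1 y.2) y.
Proof.
move=> /andP[yq yp]; apply: differentiable_mulmx.
  exact: differentiable_ker_proj2.
by have := differentiable_quot_mx (differentiable_sub_coord yq) yp; apply.
Qed.

Lemma differentiable_frame_trans v w (y : V) : frame_dom w y.1 y.2 ->
  differentiable (fun y : V => frame_trans v w y.1 y.2) y.
Proof.
move=> dw; apply: differentiableD; apply: differentiable_mulmx.
- exact: differentiable_frame1.
- exact: differentiable_coframe1.
- exact: differentiable_frame2.
- exact: differentiable_coframe2.
Qed.

Lemma differentiable_at_time (W : normedModType C) (f : V -> W) x t :
  differentiable f (x, t) -> differentiable (fun x => f (x, t)) x.
Proof.
move=> df; have dg : differentiable (fun x : 'rV[C]_n.+1 => (x, t)) x.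
  by apply: differentiable_pair => //; exact: differentiable_cst.
exact: (differentiable_comp dg df).
Qed.

End FrameHolo.

Section Degeneration.
Variables (R : realType) (rho : {posnum R}) (n : nat).
Notation C := R[i].
Notation P := (pspace_atlas R n).
Notation PD := (prod_atlas P (disc_atlas rho)).

(** Matrices act on row vectors from the right, so the transition from v to w lifts
    by the frame of v and then takes coordinates with the coframe of w. *)
Definition degeneration : cocycle PD n := @Cocycle _ _ PD n
  ('I_n.+1 * 'I_n.+1)%type
  (fun v => [set y : PD | frame_dom v (hcoord y.1) (val y.2)])
  (fun v w y => frame_trans v w (hcoord y.1) (val y.2)).

Lemma open_frame_dom v :
  open_on [set y : PD | frame_dom v (hcoord y.1) (val y.2)].
Proof.
pose f (y : PD) := sub_coord v.1 (hcoord y.1) (val y.2) 0 v.2.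
pose U := [set y : PD | hcoord y.1 0 v.1 != 0].
have oU : open_on U by exact: (open_on_prod (@open_on_hcoord R n v.1)).
have hf : holomorphic_on U f.
  apply: (@holomorphic_homog_prod R n rho _
    (fun z : 'rV[C]_n.+1 * C => sub_coord v.1 z.1 z.2 0 v.2)).
    by move=> c x t c0 /=; rewrite sub_coordZ.
  move=> y Uy; have := @differentiable_sub_coord R n v.1 (hcoord y.1, val y.2) Uy.
  by move=> /differentiable_mxP/(_ 0 v.2).
rewrite (_ : [set y | _] = U `&` [set y | f y != 0]).
  exact: open_on_neq0.
by apply/seteqP; split=> y /andP.
Qed.

Lemma degeneration_vbundle : is_vbundle degeneration.
Proof.
split.
- exact: open_frame_dom.
- by move=> y; apply: frame_dom_cover; exact: hcoord_neq0.
- move=> v w; apply: (@holomorphic_homog_prod R n rho _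
    (fun z : 'rV[C]_n.+1 * C => frame_trans v w z.1 z.2)).
    by move=> c x t c0 /=; rewrite frame_transZ.
  move=> y [_ dw]; exact: (@differentiable_frame_trans R n v w (hcoord y.1, val y.2)).
- by move=> v y dv; exact: frame_trans_id.
- by move=> u v w y _ dv dw; exact: frame_trans_mul.
Qed.

End Degeneration.

Section Tangent.
Variables (R : realType) (n : nat).
Notation C := R[i].
Notation P := (pspace_atlas R n).

Lemma diff_coord m (z v : 'rV[C]_m) k :
  'd (fun w : 'rV[C]_m => w 0 k : C) z v = v 0 k.
Proof.
have @f : {linear 'rV[C]_m -> C}.
  by exists (fun N : 'rV[C]_m => N 0 k); do 2![eexists]; do ?[constructor];
     rewrite ?mxE// => ? *; rewrite ?mxE//; move=> ?; rewrite !mxE.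
rewrite (_ : (fun _ => _) = f) // diff_lin//; exact: coord_continuous.
Qed.

Lemma mul_lift_mx (a l : 'I_n.+1) (v : 'rV[C]_n) :
  (v *m lift_mx C a) 0 l = oapp (v 0) 0 (unlift a l).
Proof.
rewrite mxE; under eq_bigr do rewrite mxE.
case: (unliftP a l) => [k ->|->] /=.
  under eq_bigr do rewrite (inj_eq lift_inj) eq_sym.
  exact: sumr_deltar.
by rewrite big1// => k _; rewrite (negPf (neq_lift _ _)) mulr0.
Qed.

Lemma diff_affine_lift (a l : 'I_n.+1) (z v : 'rV[C]_n) :
  'd (fun w => affine_lift a w 0 l) z v = (v *m lift_mx C a) 0 l.
Proof.
rewrite mul_lift_mx (_ : (fun w => _) =
    fun w : 'rV[C]_n => oapp (w 0) 1 (unlift a l) : C); last first.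
  by apply/funext => w; rewrite mxE.
case: (unlift a l) => [k|] /=; first exact: diff_coord.
by have := @diff_cst _ _ _ (1 : C) z => /(congr1 (fun f => f v)).
Qed.

Lemma mul_quot_mx p (u al : 'rV[C]_n.+1) k : (u *m quot_mx p al) 0 k =
  u 0 (lift p k) - u 0 p * (al 0 (lift p k) / al 0 p).
Proof.
rewrite mxE; under eq_bigr do rewrite mxE mulrBr (mulrA (u 0 _)).
by rewrite sumrB -mulr_suml !sumr_deltar.
Qed.

(** The chart b composed with the parametrization a has the components
    y_l / y_b, where y is the affine lift for a; this is the quotient rule. *)
Lemma tangent_jacobian (a b : 'I_n.+1) (z : 'rV[C]_n) :
  affine_lift a z 0 b != 0 ->
  'J (chart_map P b \o par P a) z =
  lift_mx C a *m ((affine_lift a z 0 b)^-1 *: quot_mx b (affine_lift a z)).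
Proof.
move=> yb; set y := affine_lift a z.
set f := _ \o _.
have fE (k : 'I_n) : (fun w => f w 0 k) = (fun w => affine_lift a w 0 (lift b k)) *
     (fun w => (affine_lift a w 0 b)^-1).
  apply/funext => w; rewrite /f /= mxE; have [c c0 E] := hcoord_par a w.
  have sE l : (c *: affine_lift a w) 0 l = c * affine_lift a w 0 l by rewrite mxE.
  by rewrite /= in E; rewrite E !sE -mulf_div divff// mul1r.
have df : differentiable f z.
  by have := @holo_transition _ _ P a b z Logic.I ((pimage_ppar a b z).2 yb).
apply/row_matrixP => i; apply/rowP => k; rewrite !rowE mulmxA.
set v := delta_mx 0 i.
have -> : (v *m 'J f z) 0 k = 'd (fun w => f w 0 k) z v.
  rewrite /jacobian mul_rV_lin1.
  rewrite [RHS](congr1 (fun g => g v) (diff_comp df (differentiable_coord (f z) 0 k))) /=.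
  by rewrite diff_coord.
have dl l : differentiable (fun w : 'rV[C]_n => affine_lift a w 0 l) z.
  exact: differentiable_affine_lift.
have di : differentiable (fun w : 'rV[C]_n => (affine_lift a w 0 b)^-1) z.
  exact: differentiableV.
have E1 : 'd (fun w => f w 0 k) z v =
   affine_lift a z 0 (lift b k) * 'd (fun w => (affine_lift a w 0 b)^-1) z v +
   (affine_lift a z 0 b)^-1 * 'd (fun w => affine_lift a w 0 (lift b k)) z v.
  rewrite fE; exact: (congr1 (fun g => g v) (diffM (dl (lift b k)) di)).
have E2 : 'd (fun w => (affine_lift a w 0 b)^-1) z v =
   - (affine_lift a z 0 b) ^- 2 * 'd (fun w => affine_lift a w 0 b) z v.
  exact: (congr1 (fun g => g v) (diffV (dl b) yb)).
have D l := diff_affine_lift a l z v.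
apply: (etrans E1); apply: (etrans (congr2 (fun p q => affine_lift a z 0 (lift b k) * p
  + (affine_lift a z 0 b)^-1 * q)
  (etrans E2 (congr1 (fun p => - (affine_lift a z 0 b) ^- 2 * p) (D b))) (D (lift b k)))).
move: (v *m _) => u; rewrite -/y in yb *.
rewrite -scalemxAr -/y.
transitivity ((y 0 b)^-1 * (u *m quot_mx b y) 0 k); last by rewrite [RHS]mxE.
by rewrite mul_quot_mx; field.
Qed.

End Tangent.

(** * Fibres off the origin *)

Lemma mx11_mul (F : pzRingType) n (c : 'M[F]_1) (A : 'M[F]_(1, n)) :
  c *m A = c 0 0 *: A.
Proof.
by apply/matrixP => i j; rewrite !mxE big_ord1 !ord1.
Qed.

Section TangentFrames.
Variables (F : numFieldType) (n : nat).
Implicit Types (x : 'rV[F]_n.+1) (a : 'I_n.+1).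

(** The Euler sequence on the chart a: a tangent vector is lifted to degree 1
    vectors with entry 0 at a, and a vector modulo x has as coordinates the
    derivatives of the quotients x_k / x_a. *)
Definition tframe a x : 'M[F]_(n, n.+1) := x 0 a *: lift_mx F a.
Definition tcoframe a x : 'M[F]_(n.+1, n) := (x 0 a)^-1 *: quot_mx a x.

Lemma tcoframe_euler a x : x 0 a != 0 -> x *m tcoframe a x = 0.
Proof. by move=> xa; rewrite -scalemxAr quot_vec// scaler0. Qed.

Lemma tcoframe_frame m a x (V : 'M[F]_(m, n.+1)) : x 0 a != 0 ->
  exists k : 'cV[F]_m, V *m tcoframe a x *m tframe a x = V - k *m x.
Proof.
move=> xa; exists ((x 0 a)^-1 *: col a V).
rewrite /tcoframe /tframe -(scalemxAr _ V) -[X in X *: lift_mx _ _]invrK.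
rewrite mulmxZZ ?invr_eq0//.
by rewrite quot_lift.
Qed.

Lemma tcoframeZ c a x : c != 0 -> tcoframe a (c *: x) = c^-1 *: tcoframe a x.
Proof. by move=> c0; rewrite /tcoframe quot_mxZ// mxE invfM scalerA. Qed.

End TangentFrames.

Section TangentIso.
Variables (R : realType) (rho : {posnum R}) (n : nat).
Notation C := R[i].
Notation P := (pspace_atlas R n).

Lemma tangent_onP a (L : P) : trivial_on (tangent P) a L <-> hcoord L 0 a != 0.
Proof. exact: pimage. Qed.

Lemma tangent_trans a b (L : P) : hcoord L 0 a != 0 -> hcoord L 0 b != 0 ->
  trans (tangent P) a b L = tframe a (hcoord L) *m tcoframe b (hcoord L).
Proof.
move=> /tangent_onP[z _ <-] xb.
have [c c0 E] := hcoord_par a z; rewrite E in xb *.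
have yb : affine_lift a z 0 b != 0.
  by apply: contra xb => /eqP yb; rewrite mxE yb mulr0.
rewrite tcoframeZ// /tframe /trans /tangent /=.
have -> : (c *: affine_lift a z) 0 a = c.
  by rewrite !mxE unlift_none mulr1.
have PK := @parK _ _ P a z Logic.I.
rewrite -[X in 'J _ X]/(chart_map P a (par P a z)) PK.
rewrite (tangent_jacobian yb) -scalemxAl -[in RHS]scalemxAr scalerA.
by rewrite divff// scale1r.
Qed.

Lemma monad_unit (t : C) : (0 < n)%N -> t != 0 -> monad_mx n t \in unitmx.
Proof.
move=> n0 t0; rewrite -row_free_unit; apply: inj_row_free => v.
exact: monad_inj.
Qed.

Lemma open_on_slice (t : disc_atlas rho)
  (U : set (prod_atlas P (disc_atlas rho))) : open_on U ->
  open_on (X := P) [set L | U (L, t)].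
Proof.
move=> oU a.
have := oU (a, tt); rewrite !openE => H z [dz Uz].
have dt : dom (disc_atlas rho) tt (val t) by exact: (valP t).
have tK : par (disc_atlas rho) tt (val t) = t by exact: valKd.
have /H : (dom (prod_atlas P (disc_atlas rho)) (a, tt) `&`
    par (prod_atlas P (disc_atlas rho)) (a, tt) @^-1` U) (z, val t).
  by split; [split|rewrite /preimage /= [insubd _ _]tK].
move=> [[A B] /= [nA nB] AB]; rewrite /interior.
apply: filterS nA => w Aw.
have [[dw _] Uw] := AB (w, val t) (conj Aw (nbhs_singleton nB)).
split=> //; move: Uw; by rewrite /preimage /= [insubd _ _]tK.
Qed.

(** The isomorphism lifts to the kernel of b, forgets the component in O(2),
    applies the inverse of S - t E_00, which maps a to x, and projects to the
    quotient by x. *)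
Lemma slice_tangent (t : disc_atlas rho) : (0 < n)%N -> val t != 0 ->
  isomorphic (slice (degeneration rho n) t) (tangent P).
Proof.
move=> n0 t0; set M := monad_mx n (val t).
have uM : M \in unitmx by exact: monad_unit.
have sub1K x : sub1 x (val t) *m invmx M = x by rewrite /sub1 mulmxK.
pose h v a (L : P) :=
  frame1 v (hcoord L) (val t) *m invmx M *m tcoframe a (hcoord L).
exists h; split.
- move=> v a.
  apply: (@holomorphic_homog R n _ (fun x : 'rV[C]_n.+1 =>
    frame1 v x (val t) *m invmx M *m tcoframe a x)).
    by move=> c x c0; rewrite frame1Z tcoframeZ// -scalemxAl mulmxZZ.
  move=> L [_ /tangent_onP La].
  apply: differentiable_mulmx.
    apply: differentiable_mulmx; last exact: differentiable_cst.
    apply: (@differentiable_at_time R n _ (fun y => frame1 v y.1 y.2)).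
    exact: differentiable_frame1.
  apply: (@differentiable_at_time R n _ (fun y => tcoframe a y.1) _ 0).
  apply: differentiable_scalemx.
    by apply: differentiable_inv => //; exact: differentiable_entry.
  apply: (@differentiable_quot_mx R n a (fun y => y.1)) => //.
  exact: differentiable_fst1.
- move=> v a L /= dv /tangent_onP La; set x := hcoord L in dv La *.
  rewrite -row_free_unit; apply: inj_row_free => u; rewrite /h -/x 2!mulmxA => uh.
  have [k] := tcoframe_frame (u *m frame1 v x (val t) *m invmx M) La.
  rewrite uh mul0mx => /esym/eqP; rewrite subr_eq0 => /eqP E.
  have E1 : u *m frame1 v x (val t) = k *m sub1 x (val t).
    by rewrite -[LHS](mulmxKV uM) E -mulmxA.
  have E2 : u *m frame2 v x = k *m sub2 x.
    have f2 : val t *: frame2 v x = - (frame1 v x (val t) *m x^T).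
      by apply/eqP; rewrite -addr_eq0 addrC frame_comp.
    have s2 : val t *: sub2 x = - (sub1 x (val t) *m x^T).
      by apply/eqP; rewrite -addr_eq0 addrC sub_comp.
    apply: (scalerI t0); rewrite (scalemxAr _ u) (scalemxAr _ k) f2 s2 !mulmxN.
    by rewrite (mulmxA u) E1 -(mulmxA k).
  have := frame_trans_id dv; rewrite /frame_trans => fid.
  rewrite -[u]mulmx1 -fid mulmxDr mulmxA (mulmxA u (frame2 v x)) E1 E2.
  by rewrite -!(mulmxA k) -mulmxDr sub_coframe// mulmx0.
- move=> v w a b L dv dw /tangent_onP La /tangent_onP Lb.
  rewrite tangent_trans// /h -[trans _ v w L]/(frame_trans v w (hcoord L) (val t)).
  set x := hcoord L in La Lb *.
  have {}dw : frame_dom w x (val t) by exact: dw.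
  have [k [E1 _]] := frame_trans_frame v dw.
  rewrite 2!mulmxA E1 mulmxBl mulmxBl -(mulmxA k) sub1K -(mulmxA k).
  rewrite tcoframe_euler// mulmx0 subr0.
  rewrite mulmxA.
  have [k' ->] := tcoframe_frame (frame1 v x (val t) *m invmx M) La.
  by rewrite mulmxBl -(mulmxA k') tcoframe_euler// mulmx0 subr0.
Qed.

End TangentIso.

(** * Twisting by a line bundle and limits along lines *)

Section Tens1.
Variables (F : comPzRingType) (n : nat).

(** The fibre of a tensor product with a line bundle has the index set of pairs
    (k, 0); these maps identify it with the original fibre. *)
Definition tens1 (w : 'rV[F]_n) : 'rV[F]_(n * 1) := \row_j w 0 (mxtens_unindex j).1.
Definition untens1 (s : 'rV[F]_(n * 1)) : 'rV[F]_n :=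
  \row_k s 0 (mxtens_index (k, ord0)).

Lemma tens1K : cancel tens1 untens1.
Proof. by move=> w; apply/rowP => k; rewrite !mxE mxtens_indexK. Qed.

Lemma untens1K : cancel untens1 tens1.
Proof.
move=> s; apply/rowP => j; rewrite !mxE; congr (s 0 _).
by rewrite -[RHS]mxtens_unindexK; congr mxtens_index; apply/pair_equal_spec;
  split=> //; rewrite [RHS]ord1.
Qed.

Lemma tens1Z c w : tens1 (c *: w) = c *: tens1 w.
Proof. by apply/rowP => j; rewrite !mxE. Qed.

Lemma tens1_0 : tens1 0 = 0.
Proof. by apply/rowP => j; rewrite !mxE. Qed.

Lemma tens1_mul w (A : 'M[F]_n) c :
  tens1 w *m (A *t (c%:M : 'M[F]_1)) = tens1 (c *: (w *m A)).
Proof.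
apply/rowP => j; rewrite !mxE mulr_sumr.
rewrite (reindex (fun k : 'I_n => mxtens_index (k, ord0 : 'I_1))); last first.
  exists (fun i => (mxtens_unindex i).1) => i _; first by rewrite mxtens_indexK.
  rewrite -[RHS]mxtens_unindexK; congr mxtens_index; apply/pair_equal_spec.
  by split=> //; rewrite [RHS]ord1.
apply: eq_bigr => k _.
by rewrite !mxE mxtens_indexK [(mxtens_unindex j).2]ord1 /= mulr1n; ring.
Qed.

End Tens1.

Section Identity.
Variables (R : realType) (n : nat).
Notation C := R[i].
Notation P := (pspace_atlas R n).

Lemma near_ppoint (U : set P) (x : 'rV[C]_n.+1) : open_on U -> x != 0 ->
  U (ppoint x) -> \forall y \near x, U (ppoint y).
Proof.
move=> oU /rV0Pn[i xi] Ux.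
have Ui : (dom P i `&` par P i @^-1` U) (affine_coord i x).
  by split=> //; rewrite /preimage /mkset -(ppoint_affine_coord xi).
have ni := open_nbhs_nbhs (conj (oU i) Ui).
have cx := differentiable_continuous (differentiable_affine_coord xi).
have cxi := differentiable_continuous (@differentiable_coord _ _ _ x 0 i).
have n0 := near_neq0 cxi xi.
by apply: filterS2 n0 (cx _ ni) => y yi [_]; rewrite (ppoint_affine_coord yi).
Qed.

(** By continuity: f vanishes on the punctured line through x in the direction
    e. *)
Lemma vanishing_at_end (U : set P) (f : P -> C) (x e : 'rV[C]_n.+1) :
  open_on U -> holomorphic_on U f -> x != 0 -> U (ppoint x) ->
  (forall z, z != 0 -> U (ppoint (x + z *: e)) -> f (ppoint (x + z *: e)) = 0) ->
  f (ppoint x) = 0.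
Proof.
move=> oU hf x0 Ux fz.
pose g z := x + z *: e.
have g0 : g 0 = x by rewrite /g scale0r addr0.
have cg : {for 0, continuous g}.
  apply: differentiable_continuous; apply: differentiableD.
    exact: differentiable_cst.
  exact: (@differentiable_scalemx _ _ _ _ id (cst e)).
have cfg : {for 0, continuous (f \o @ppoint R n \o g)}.
  apply: continuous_comp => //; rewrite g0.
  exact/differentiable_continuous/(differentiable_ppoint hf).
have nU : \forall z \near (0 : C), U (ppoint (g z)).
  by apply: (cg [set y | U (ppoint y)]); rewrite g0; exact: near_ppoint.
have [//|fx] := eqVneq (f (ppoint x)) 0.
rewrite -g0 in fx; have nf := near_neq0 cfg fx.
have nUf : nbhs (0 : C) [set z | U (ppoint (g z)) /\ f (ppoint (g z)) != 0].
  exact: filterI nU nf.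
have /nbhs_ballP[r /= r0 rP] := nUf.
have r20 : 0 < r / 2 by rewrite divr_gt0.
have [|Uz] := rP (r / 2).
  rewrite -ball_normE /ball_ /= sub0r normrN gtr0_norm//.
  by rewrite ltr_pdivrMr// ltr_pMr// ltr1n.
by rewrite fz ?eqxx// gt_eqF.
Qed.

End Identity.

(** * Sections over the central fibre *)

Section CentralFrames.
Variables (F : numFieldType) (n : nat).
Implicit Types (v w : 'I_n.+1 * 'I_n.+1) (x : 'rV[F]_n.+1).

(** At t = 0 the vector (0, 1) is in the kernel of b, and its coordinates are given
    by [coframe2]. *)
Lemma coframe2_frame v x : frame_dom v x 0 -> exists k : F,
  coframe2 v x 0 *m frame1 v x 0 = - (k *: sub1 x 0) /\
  coframe2 v x 0 *m frame2 v x = 1%:M - k *: sub2 x.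
Proof.
move=> dv; have [|k] := @coframe_frame _ _ 1 v x 0 0 1%:M dv.
  by rewrite mul0mx scale0r addr0.
by rewrite mul0mx add0r mul1mx sub0r !mx11_mul; exists (k 0 0).
Qed.

Lemma coframe2_trans v w x : frame_dom v x 0 -> frame_dom w x 0 ->
  coframe2 v x 0 *m frame_trans v w x 0 = coframe2 w x 0.
Proof.
move=> dv dw; have [k [E1 E2]] := coframe2_frame dv.
rewrite /frame_trans mulmxDr (mulmxA _ (frame1 v x 0)) (mulmxA _ (frame2 v x)).
rewrite E1 E2 mulmxBl mul1mx mulNmx addrCA -opprD -!scalemxAl -scalerDr.
by rewrite sub_coframe// scaler0 subr0.
Qed.

Lemma coframe2_neq0 v x : frame_dom v x 0 -> sub1 x 0 != 0 ->
  coframe2 v x 0 != 0.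
Proof.
move=> dv s1; have [k [E1 E2]] := coframe2_frame dv.
apply/eqP => c0; move: E1 E2; rewrite c0 !mul0mx => /esym/eqP.
rewrite oppr_eq0 scaler_eq0 (negPf s1) orbF => /eqP ->.
rewrite scale0r subr0 => /matrixP/(_ 0 0)/eqP; rewrite !mxE eqxx eq_sym.
by rewrite oner_eq0.
Qed.

Lemma sub1_delta0 (j : 'I_n.+1) :
  sub1 (delta_mx 0 ord0 : 'rV[F]_n.+1) 0 0 j = - (j == 1 :> nat)%:R.
Proof. by rewrite /sub1 monad_mx0 -rowE !mxE /= sub0r. Qed.

Lemma sub1_delta1 (i j : 'I_n.+1) : i = 1 :> nat ->
  sub1 (delta_mx 0 i : 'rV[F]_n.+1) 0 0 j = (j == 0 :> nat)%:R - (j == 2 :> nat)%:R.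
Proof.
by move=> i1; rewrite /sub1 monad_mx0 -rowE !mxE i1 eqSS [0 == _]eq_sym.
Qed.

End CentralFrames.

Lemma wedge_mul (R : realType) n (x u v : 'rV[R[i]]_n.+1) :
  x *m wedge u v = (x *m u^T) 0 0 *: v - (x *m v^T) 0 0 *: u.
Proof. by rewrite /wedge mulmxBr !mulmxA !mx11_mul. Qed.

Lemma wedge_eq0 (R : realType) n (u v : 'rV[R[i]]_n.+1) l :
  wedge u v = 0 -> v 0 l != 0 -> u = (u 0 l / v 0 l) *: v.
Proof.
move=> /matrixP uv vl; apply/rowP => k; have := uv k l.
rewrite wedgeE !mxE => /eqP; rewrite subr_eq0 => /eqP E.
by rewrite mulrAC [u 0 l * _]mulrC -E mulfK.
Qed.

Lemma coframe2_trans_mul (F : numFieldType) n m v w (x : 'rV[F]_n.+1)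
    (H : 'M[F]_(n, m)) : frame_dom v x 0 -> frame_dom w x 0 ->
  coframe2 v x 0 *m (frame_trans v w x 0 *m H) = coframe2 w x 0 *m H.
Proof. by move=> dv dw; rewrite mulmxA coframe2_trans. Qed.

Section CentralCocycle.
Variables (R : realType) (rho : {posnum R}) (n : nat).
Notation C := R[i].
Notation P := (pspace_atlas R n).
Notation V0 := (slice (degeneration rho n) (disc0 rho)).

Lemma val_disc0 : val (disc0 rho) = 0.
Proof. by []. Qed.

Lemma central_trans v w (L : P) :
  trans V0 v w L = frame_trans v w (hcoord L) 0.
Proof. by rewrite -[RHS](congr1 _ val_disc0). Qed.

Lemma open_frame_dom0 v : open_on [set L : P | frame_dom v (hcoord L) 0].
Proof.
have := @open_on_slice R rho n (disc0 rho) _ (@open_frame_dom R rho n v).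
by rewrite /=.
Qed.

Lemma holomorphic_coframe2 (v : 'I_n.+1 * 'I_n.+1) a :
  holomorphic_on [set L : P | frame_dom v (hcoord L) 0]
    (fun L => hcoord L 0 a ^+ 2 *: coframe2 v (hcoord L) 0).
Proof.
apply: (@holomorphic_homog R n _ (fun x => (x 0 a) ^+ 2 *: coframe2 v x 0)).
  move=> c x c0; rewrite coframe2Z// mxE scalerA exprMn mulrAC divff ?mul1r//.
  by rewrite expf_neq0.
move=> M di.
apply: (@differentiable_at_time R n _ (fun y => (y.1 0 a) ^+ 2 *: coframe2 v y.1 y.2)).
apply: differentiable_scalemx; last exact: differentiable_coframe2.
by apply: differentiable_exprn; exact: differentiable_entry.
Qed.

End CentralCocycle.

Section Twist.
Variables (R : realType) (n : nat).
Notation C := R[i].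
Notation P := (pspace_atlas R n).

(** Dividing by the square of a homogeneous coordinate absorbs the transition
    functions of O(-2): the result depends only on the trivialization of V. *)
Lemma twist_section (V : cocycle P n) s v w i j (L : P) :
  global_section (V := twist V (- 2)) s ->
  trivial_on V v L -> trivial_on V w L ->
  hcoord L 0 i != 0 -> hcoord L 0 j != 0 ->
  (hcoord L 0 j) ^- 2 *: untens1 (s (w, j) L) =
  ((hcoord L 0 i) ^- 2 *: untens1 (s (v, i) L)) *m trans V v w L.
Proof.
move=> [_ sE] dv dw xi xj.
have := sE (v, i) (w, j) L (conj dv xi) (conj dw xj).
rewrite -{1}(untens1K (s (v, i) L)) [X in _ = X -> _]tens1_mul.
move=> /(congr1 (@untens1 _ _)); rewrite tens1K => ->.
rewrite scalerA -scalemxAl; congr (_ *: _).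
have -> (y : C) : y ^ (- 2) = y ^- 2 by [].
by rewrite /=; field; rewrite xi.
Qed.

End Twist.

Section CentralSections.
Variables (R : realType) (rho : {posnum R}) (n : nat).
Notation C := R[i].
Notation P := (pspace_atlas R n).
Notation V0 := (slice (degeneration rho n) (disc0 rho)).
Variable s : triv (twist V0 (- 2)) -> P -> 'rV[C]_(n * 1).
Hypothesis sP : global_section s.

(* The section divided by x_i^2 is [reduced], homogeneous of degree -2 in the
   representative of the point.  Its lift (lift1, lift2) to the kernel of b is
   determined up to multiples of a = (y, x_0^2). *)
Let I := triv (twist V0 (- 2)).
Let xe (i : I) (L : P) : C := hcoord L 0 i.2.
Let U (i : I) : set P := trivial_on (twist V0 (- 2)) i.
Let reduced (i : I) (L : P) : 'rV[C]_n := xe i L ^- 2 *: untens1 (s i L).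
Let lift1 (i : I) (L : P) := reduced i L *m frame1 i.1 (hcoord L) 0.
Let lift2 (i : I) (L : P) := (reduced i L *m frame2 i.1 (hcoord L)) 0 0.
Let y (L : P) := sub1 (hcoord L) 0.

Lemma domP i L : U i L -> frame_dom i.1 (hcoord L) 0 /\ xe i L != 0.
Proof. by []. Qed.

Lemma open_dom_twist i : open_on (U i).
Proof.
apply: open_onI; first exact: open_frame_dom0.
exact: open_on_hcoord.
Qed.

Lemma dom_twist_cover L : exists i, U i L.
Proof.
have L0 := hcoord_neq0 L; have [v dv] := frame_dom_cover 0 L0.
by have /rV0Pn[i xi] := L0; exists (v, i).
Qed.

Lemma reduced_trans i j L : U i L -> U j L ->
  reduced j L = reduced i L *m frame_trans i.1 j.1 (hcoord L) 0.
Proof.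
case: i j => [v i] [w j] [dv xi] [dw xj].
exact: (@twist_section R n V0 s v w i j L sP dv dw xi xj).
Qed.

Lemma reduced_lift i L : U i L -> reduced i L =
  lift1 i L *m coframe1 i.1 (hcoord L) 0 + lift2 i L *: coframe2 i.1 (hcoord L) 0.
Proof.
move=> /domP[di _]; have := frame_trans_id di; rewrite /frame_trans => fid.
by rewrite /lift1 /lift2 -mx11_mul -2!(mulmxA (reduced i L)) -mulmxDr fid mulmx1.
Qed.

Lemma lift_glue i j L : U i L -> U j L -> exists k,
  lift1 j L = lift1 i L - k *: y L /\ lift2 j L = lift2 i L - k * hcoord L 0 0 ^+ 2.
Proof.
move=> Ui Uj; have [k [E1 E2]] := frame_trans_frame i.1 (domP Uj).1.
exists ((reduced i L *m k) 0 0); rewrite /lift1 /lift2 (reduced_trans Ui Uj).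
rewrite -2!(mulmxA (reduced i L)) E1 E2.
rewrite !mulmxBr 2!(mulmxA _ k) !mx11_mul; split=> //.
have mxBE (M N : 'M[C]_1) c : (M - c *: N) 0 0 = M 0 0 - c * N 0 0 by rewrite !mxE.
have s2E : sub2 (hcoord L) 0 0 = hcoord L 0 0 ^+ 2 by rewrite mxE eqxx.
by rewrite mxBE s2E.
Qed.

(** At t = 0 the equation b = 0 only concerns the component in O(1)^(n+1). *)
Lemma lift1_orth i L : lift1 i L *m (hcoord L)^T = 0.
Proof.
have := frame_comp i.1 (hcoord L) 0; rewrite scale0r addr0 => E.
by rewrite /lift1 -mulmxA E mulmx0.
Qed.

Lemma holomorphic_untens1 i : holomorphic_on (U i) (fun L => untens1 (s i L)).
Proof.
have /holomorphic_on_mxP hs := sP.1 i.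
apply/holomorphic_on_mxP => a k; under eq_fun do rewrite mxE; exact: hs.
Qed.

Lemma holomorphic_lift1 i : holomorphic_on (U i) (fun L => xe i L *: lift1 i L).
Proof.
have hf : holomorphic_on (U i) (fun L => (xe i L)^-1 *: frame1 i.1 (hcoord L) 0).
  apply: (@holomorphic_homog R n _ (fun x => (x 0 i.2)^-1 *: frame1 i.1 x 0)).
    by move=> c x c0; rewrite frame1Z mxE scalerA invfM mulrAC mulVf// mul1r.
  move=> L [_ xi].
  apply: (@differentiable_at_time R n _ (fun y => (y.1 0 i.2)^-1 *: frame1 i.1 y.1 y.2)).
  apply: differentiable_scalemx; last exact: differentiable_frame1.
  by apply: differentiable_inv => //; exact: differentiable_entry.
have := holomorphic_on_mulmx (@holomorphic_untens1 i) hf.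
apply: holomorphic_eq_on; first exact: open_dom_twist.
move=> L [_ xi]; rewrite -scalemxAr /lift1 /reduced -scalemxAl scalerA.
by congr (_ *: _); rewrite /xe; field.
Qed.

(** The constant bivector is killed by contraction with x, by [lift1_orth] and
    [skew_alt], and the x span the whole space. *)
Lemma wedge_lift1 i L : U i L -> wedge (lift1 i L) (y L) = 0.
Proof.
have glue i' j' L' : U i' L' -> U j' L' -> exists g,
    lift1 i' L' = lift1 j' L' + g *: (hcoord L' *m monad_mx n 0).
  move=> Ui Uj; have [k [-> _]] := lift_glue Uj Ui; exists (- k).
  by rewrite scaleNr.
have [c cE] := @wedge_const R n (monad_mx n 0) I U (fun i => i.2) lift1
  open_dom_twist dom_twist_cover (fun i L UL => (domP UL).2) holomorphic_lift1 glue.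
move=> Ui; rewrite [wedge _ _](cE i L Ui).
have xc (M : P) : hcoord M *m c = 0.
  have [j Uj] := dom_twist_cover M; rewrite -(cE j M Uj) wedge_mul.
  have -> : hcoord M *m (lift1 j M)^T = 0.
    by rewrite -[LHS]trmxK trmx_mul trmxK lift1_orth trmx0.
  rewrite monad_mx0 -[hcoord M *m (_ *m _)^T]trmxK trmx_mul trmxK skew_alt.
  by rewrite trmx0 !mxE !scale0r subrr.
apply/row_matrixP => k; rewrite row0 rowE.
have k0 : delta_mx 0 k != 0 :> 'rV[C]_n.+1.
  by apply/rV0Pn; exists k; rewrite mxE !eqxx oner_eq0.
have [a a0 aE] := hcoord_ppoint k0.
by have := xc (ppoint (delta_mx 0 k)); rewrite aE -scalemxAl => /eqP;
  rewrite scaler_eq0 (negPf a0) => /eqP.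
Qed.

(* Where y <> 0 the vector lift1 is g y, and [corr] is the component in O(2) that
   remains after subtraction of g a; the index l of a nonzero entry of y serves to
   compute g. *)
Let J := (I * 'I_n.+1)%type.
Let corr_dom (j : J) : set P := U j.1 `&` [set L | y L 0 j.2 != 0].
Let corr (j : J) (L : P) : C :=
  lift2 j.1 L - lift1 j.1 L 0 j.2 / y L 0 j.2 * hcoord L 0 0 ^+ 2.

Lemma differentiable_sub1_entry l (x : 'rV[C]_n.+1) :
  differentiable (fun x => sub1 x 0 0 l) x.
Proof.
have /differentiable_mxP/(_ 0 l) := differentiable_at_time
  (@differentiable_sub1 R n (x, 0)).
by [].
Qed.

Lemma open_corr_dom j : open_on (corr_dom j).
Proof.
rewrite (_ : corr_dom j = U j.1 `&` [set L | y L 0 j.2 / xe j.1 L != 0]).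
  apply: open_on_neq0; first exact: open_dom_twist.
  apply: (@holomorphic_homog R n _ (fun x => sub1 x 0 0 j.2 / x 0 j.1.2)).
    by move=> c x c0; rewrite sub1Z !mxE -mulf_div divff// mul1r.
  move=> L [_ xi]; apply: differentiableM; first exact: differentiable_sub1_entry.
  by apply: differentiableV => //; exact: differentiable_coord.
apply/seteqP; split=> L [UL yL]; split=> //=; have [_ xi] := domP UL.
  by rewrite mulf_neq0 ?invr_eq0.
by apply: contra yL => /eqP ->; rewrite mul0r.
Qed.

Lemma lift1_prop i l L : U i L -> y L 0 l != 0 ->
  lift1 i L = (lift1 i L 0 l / y L 0 l) *: y L.
Proof. by move=> Ui yl; exact: wedge_eq0 (wedge_lift1 Ui) yl. Qed.

Lemma holomorphic_corr j : holomorphic_on (corr_dom j) (corr j).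
Proof.
have h2 : holomorphic_on (corr_dom j) (fun L => (untens1 (s j.1 L) *m
    (xe j.1 L ^- 2 *: frame2 j.1.1 (hcoord L))) 0 0).
  apply: holomorphic_onS (_ : corr_dom j `<=` U j.1) _; first by move=> L [].
  have hf : holomorphic_on (U j.1) (fun L => xe j.1 L ^- 2 *: frame2 j.1.1 (hcoord L)).
    apply: (@holomorphic_homog R n _ (fun x => (x 0 j.1.2) ^- 2 *: frame2 j.1.1 x)).
      move=> c x c0; rewrite frame2Z mxE scalerA exprMn invfM mulrAC mulVf ?mul1r//.
      by rewrite expf_neq0.
    move=> L [_ xi].
    apply: (@differentiable_at_time R n _ (fun y => (y.1 0 j.1.2) ^- 2 *: frame2 j.1.1 y.1) _ 0).
    apply: differentiable_scalemx; last exact: differentiable_frame2.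
    apply: differentiable_inv; last by rewrite expf_neq0.
    by apply: differentiable_exprn; exact: differentiable_entry.
  by have /holomorphic_on_mxP/(_ 0 0) := holomorphic_on_mulmx (@holomorphic_untens1 j.1) hf.
have h1 : holomorphic_on (corr_dom j) (fun L => (xe j.1 L *: lift1 j.1 L) 0 j.2).
  apply: holomorphic_onS (_ : corr_dom j `<=` U j.1) _; first by move=> L [].
  by have /holomorphic_on_mxP/(_ 0 j.2) := @holomorphic_lift1 j.1.
have h3 : holomorphic_on (corr_dom j) (fun L => hcoord L 0 0 ^+ 2 / (xe j.1 L * y L 0 j.2)).
  apply: (@holomorphic_homog R n _ (fun x => x 0 0 ^+ 2 / (x 0 j.1.2 * sub1 x 0 0 j.2))).
    move=> c x c0; rewrite sub1Z !mxE mulrACA -expr2 exprMn.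
    by rewrite -mulf_div divff ?mul1r// expf_neq0.
  move=> L [[_ xi] yl].
  apply: differentiableM.
    apply: (@differentiable_at_time R n _ (fun y => y.1 0 0 ^+ 2) _ 0).
    by apply: differentiable_exprn; exact: differentiable_entry.
  apply: differentiableV; last by rewrite mulf_neq0.
  by apply: differentiableM; [exact: differentiable_coord|exact: differentiable_sub1_entry].
have := holomorphic_onB h2 (holomorphic_onM h1 h3).
apply: holomorphic_eq_on; first exact: open_corr_dom.
move=> L [[_ xi] /= yl]; rewrite /corr; congr (_ - _).
  by rewrite /lift2 /reduced -scalemxAl -scalemxAr.
by rewrite mxE /xe; field; rewrite yl.
Qed.

Lemma corr_glue i j L : corr_dom i L -> corr_dom j L -> corr i L = corr j L.
Proof.
move=> [Ui yi] [Uj yj]; have [k [E1 E2]] := lift_glue Ui Uj.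
have P1 : lift1 i.1 L 0 j.2 = lift1 i.1 L 0 i.2 / y L 0 i.2 * y L 0 j.2.
  by rewrite {1}(lift1_prop Ui yi) mxE.
rewrite /corr E2 E1.
have sE (u v : 'rV[C]_n.+1) c l : (u - c *: v) 0 l = u 0 l - c * v 0 l by rewrite !mxE.
rewrite sE P1.
by field; rewrite yi yj.
Qed.

(** The line through two points u and v avoids the kernel of S when u S and v S
    are independent.  The images of the first two basis vectors e_0 and e_1 are
    independent, and any vector outside the kernel has an image independent of
    one of these two. *)
Lemma corr_const : (0 < n)%N -> exists c, forall j L, corr_dom j L -> corr j L = c.
Proof.
move=> n0; have [h hE hh] := holomorphic_glue (@open_corr_dom) (@holomorphic_corr) corr_glue.
pose W := [set L | exists j, corr_dom j L].
have WP L : y L != 0 -> W L.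
  move=> /rV0Pn[l yl]; have [i Ui] := dom_twist_cover L.
  by exists (i, l).
have Wpl x : sub1 x 0 != 0 -> x != 0 /\ W (ppoint x).
  move=> sx; have x_0 : x != 0.
    by apply: contra sx => /eqP ->; rewrite /sub1 mul0mx.
  split=> //; apply: WP; have [a a0 aE] := hcoord_ppoint x_0.
  by rewrite /y aE sub1Z scaler_eq0 negb_or a0.
have indep u v : (forall a b, a *: sub1 u 0 + b *: sub1 v 0 = 0 ->
    a = 0 /\ b = 0) -> h (ppoint u) = h (ppoint v).
  move=> uv; apply: line_const hh _ => a b ab; apply: Wpl.
  apply/eqP; rewrite /sub1 mulmxDl -!scalemxAl => /uv[a0 b0].
  by move: ab; rewrite a0 b0 eqxx.
pose e0 : 'rV[C]_n.+1 := delta_mx 0 ord0.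
pose o1 : 'I_n.+1 := inord 1.
have o1E : o1 = 1 :> nat by rewrite inordK.
pose e1 : 'rV[C]_n.+1 := delta_mx 0 o1.
have e0E j : sub1 e0 0 0 j = - (j == 1 :> nat)%:R by exact: sub1_delta0.
have e1E j : sub1 e1 0 0 j = (j == 0 :> nat)%:R - (j == 2 :> nat)%:R.
  exact: sub1_delta1.
have lc (u v : 'rV[C]_n.+1) a b (j : 'I_n.+1) : a *: u + b *: v = 0 ->
    a * u 0 j + b * v 0 j = 0.
  by move=> /rowP/(_ j); rewrite !mxE.
have h01 : h (ppoint e1) = h (ppoint e0).
  apply: indep => a b E; have := lc _ _ _ _ o1 E; have := lc _ _ _ _ ord0 E.
  rewrite !e0E !e1E o1E /= !subr0 !oppr0 !mulr0 mulr1 mulrN1 addr0.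
  by rewrite add0r => -> /eqP; rewrite oppr_eq0 => /eqP.
exists (h (ppoint e0)) => j L Uj; rewrite -(hE j)// -(hcoordK L).
case: Uj => Ui /= yl; set yL := y L in yl *.
(* The image of e_0 is supported at 1, so an entry l <> 1 of x S gives
   independence; otherwise x S is supported at 1 and e_1 is used. *)
have [[l [l1 yl0]]|none] := pselect (exists l : 'I_n.+1, l != o1 /\ yL 0 l != 0).
  apply: indep => a b E; have := lc _ _ _ _ l E.
  rewrite e0E -o1E (inj_eq val_inj) (negPf l1) oppr0 mulr0 addr0 => /eqP.
  rewrite mulf_eq0 (negPf yl0) orbF => /eqP a0; split=> //.
  have := lc _ _ _ _ o1 E; rewrite e0E o1E a0 mul0r add0r mulrN1 => /eqP.
  by rewrite oppr_eq0 => /eqP.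
have yl0 l : l != o1 -> yL 0 l = 0.
  by move=> l1; apply/eqP/negP => /negP yl0; apply: none; exists l.
have j1 : j.2 = o1.
  by apply/eqP/negP => /negP /yl0 E; move: yl; rewrite E eqxx.
rewrite -h01; apply: indep => a b E; have := lc _ _ _ _ ord0 E.
rewrite [sub1 _ _ 0 ord0](yl0 ord0); last first.
  by apply/eqP => /(congr1 val); rewrite /= o1E.
rewrite e1E /= subr0 mulr0 add0r mulr1 => b0; split=> //.
have := lc _ _ _ _ o1 E; rewrite b0 mul0r addr0 => /eqP.
by rewrite mulf_eq0 -j1 [_ == 0 in X in _ || X](negPf yl) orbF => /eqP.
Qed.

Lemma reduced_central : (0 < n)%N -> exists c, forall i L, U i L -> y L != 0 ->
  reduced i L = c *: coframe2 i.1 (hcoord L) 0.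
Proof.
move=> n0; have [c cE] := corr_const n0; exists c => i L Ui /rV0Pn[l yl].
have := cE (i, l) L (conj Ui yl); rewrite /corr /= => /eqP.
rewrite subr_eq => /eqP E2; rewrite reduced_lift// E2 {1}(lift1_prop Ui yl).
set g := _ / _; have := sub_coframe (domP Ui).1.
rewrite mx11_mul [sub2 _ 0 0]mxE mulr1n => E.
by rewrite -scalemxAl scalerDl -scalerA addrCA -scalerDr E scaler0 addr0.
Qed.

(** Points of the kernel of S are reached as limits along the direction of e_0,
    which S does not kill. *)
Lemma section_scalar : (0 < n)%N -> exists c, forall i L, U i L ->
  untens1 (s i L) = c *: (xe i L ^+ 2 *: coframe2 i.1 (hcoord L) 0).
Proof.
move=> n0; have [c cE] := reduced_central n0; exists c => i L Ui.
have sG M : U i M -> untens1 (s i M) = xe i M ^+ 2 *: reduced i M.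
  by move=> /domP[_ xi]; rewrite /reduced scalerA divff ?scale1r// expf_neq0.
have hb : holomorphic_on (U i) (fun M => xe i M ^+ 2 *: coframe2 i.1 (hcoord M) 0).
  by apply: holomorphic_onS (@holomorphic_coframe2 R n i.1 i.2) => M [].
apply/rowP => k; apply/eqP; rewrite -subr_eq0; apply/eqP.
pose f M := untens1 (s i M) 0 k - c * (xe i M ^+ 2 *: coframe2 i.1 (hcoord M) 0) 0 k.
have hf : holomorphic_on (U i) f.
  apply: holomorphic_onB.
    by have /holomorphic_on_mxP/(_ 0 k) := @holomorphic_untens1 i.
  apply: holomorphic_onM; first by move=> a z _ _; exact: differentiable_cst.
  by have /holomorphic_on_mxP/(_ 0 k) := hb.
have f0 M : U i M -> y M != 0 -> f M = 0.
  move=> Um yM; rewrite /f sG// (cE i M Um yM) scalerA mulrC -scalerA mxE.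
  by rewrite subrr.
have -> : forall A B : 'rV[C]_n, A 0 k - (c *: B) 0 k = A 0 k - c * B 0 k.
  by move=> A B; rewrite !mxE.
have [yL|yL] := eqVneq (y L) 0; last exact: f0.
rewrite -[LHS]/(f L) -(hcoordK L).
pose e0 : 'rV[C]_n.+1 := delta_mx 0 ord0.
have se0 : sub1 e0 0 != 0.
  apply/rV0Pn; exists (inord 1); rewrite sub1_delta0 inordK// eqxx.
  by rewrite oppr_eq0 oner_eq0.
apply: (@vanishing_at_end R n (U i) f (hcoord L) e0) => //.
- exact: open_dom_twist.
- exact: hcoord_neq0.
- by rewrite hcoordK.
move=> z z0 Uz; apply: f0 => //.
have se : sub1 (hcoord L + z *: e0) 0 = z *: sub1 e0 0.
  by rewrite /sub1 mulmxDl -scalemxAl -/(sub1 (hcoord L) 0) -/(y L) yL add0r.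
have nz : hcoord L + z *: e0 != 0.
  apply/eqP => E; move: se; rewrite E /sub1 mul0mx => /esym/eqP.
  by rewrite scaler_eq0 (negPf z0) (negPf se0).
have [a a0 aE] := hcoord_ppoint nz.
by rewrite /y aE sub1Z se !scaler_eq0 (negPf a0) (negPf z0).
Qed.

End CentralSections.

(** * The central fibre *)

Section CentralFibre.
Variables (R : realType) (rho : {posnum R}) (n : nat).
Notation C := R[i].
Notation P := (pspace_atlas R n).
Notation V0 := (slice (degeneration rho n) (disc0 rho)).

(** The section of V_0(-2) given by the inclusion of O(2) in the kernel of b: in
    the i-th trivialization of O(-2) a function of degree -2 is multiplied by
    x_i^2. *)
Definition central_section (i : triv (twist V0 (- 2))) (L : P) : 'rV[C]_(n * 1) :=
  tens1 (hcoord L 0 i.2 ^+ 2 *: coframe2 i.1 (hcoord L) 0).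

Lemma central_section_global : global_section central_section.
Proof.
split=> [i|i j L [di xi] [dj xj]].
  have /holomorphic_on_mxP h := @holomorphic_coframe2 R n i.1 i.2.
  apply/holomorphic_on_mxP => a k; under eq_fun do rewrite mxE.
  by apply: holomorphic_onS (h 0 _) => L [].
rewrite /central_section [RHS]tens1_mul; congr tens1.
have -> (y : C) : y ^ (- 2) = y ^- 2 by [].
rewrite -scalemxAl [_ *m _](coframe2_trans di dj) scalerA; congr (_ *: _).
by field; rewrite xi xj.
Qed.

Lemma sub1_generic : (0 < n)%N -> exists L : P, sub1 (hcoord L) 0 != 0.
Proof.
move=> n0; pose e0 : 'rV[C]_n.+1 := delta_mx 0 ord0.
have e00 : e0 != 0 by apply/rV0Pn; exists ord0; rewrite mxE !eqxx oner_eq0.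
exists (ppoint e0); have [a a0 ->] := hcoord_ppoint e00.
rewrite sub1Z scaler_eq0 negb_or a0 /=; apply/rV0Pn; exists (inord 1).
by rewrite sub1_delta0 inordK// eqxx oppr_eq0 oner_eq0.
Qed.

(** The vector (0, 1) is not a multiple of a where the first component of a is
    nonzero. *)
Lemma central_section_neq0 : (0 < n)%N -> exists i L,
  trivial_on (twist V0 (- 2)) i L /\ central_section i L != 0.
Proof.
move=> n0; have [L yL] := sub1_generic n0; have L0 := hcoord_neq0 L.
have [v dv] := frame_dom_cover 0 L0; have /rV0Pn[a xa] := L0.
exists (v, a), L; split=> //; apply/eqP => /(congr1 (@untens1 _ _)).
rewrite tens1K -[X in _ = untens1 X](tens1_0 _ n) tens1K => /eqP.
rewrite scaler_eq0 expf_eq0 /= (negPf xa) /=.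
by apply/negP; exact: coframe2_neq0.
Qed.

Lemma h0_central : (0 < n)%N -> h0_eq (twist V0 (- 2)) 1.
Proof.
move=> n0; exists (fun=> central_section); split=> [_|s sP].
  exact: central_section_global.
have [c cE] := section_scalar sP n0.
have sE i L : trivial_on (twist V0 (- 2)) i L -> s i L = c *: central_section i L.
  by move=> Ui; rewrite -[LHS]untens1K (cE i L Ui) tens1Z.
exists (c%:M); split=> [i L Ui|c' c'E].
  by rewrite big_ord1 mxE mulr1n; exact: sE.
have [i [L [Ui b0]]] := central_section_neq0 n0.
have := c'E i L Ui; rewrite big_ord1 sE// => /eqP.
rewrite -subr_eq0 -scalerBl scaler_eq0 (negPf b0) orbF subr_eq0 => /eqP cc.
by apply/rowP => k; rewrite ord1 !mxE mulr1n.
Qed.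

Notation T := (tangent P).

(** The image of [central_section] is lifted to vectors [psi] modulo x, which form
    constant bivectors with x.  At the basis vector e_m the entry (k, l) of the
    bivector is zero if m is neither k nor l, and n >= 2 leaves room for such an
    m.  So [psi] is a multiple of x and the image vanishes, contrary to
    injectivity. *)
Lemma central_not_tangent : (1 < n)%N -> ~ isomorphic V0 T.
Proof.
move=> n1 [h [hh hu hc]]; have n0 := ltnW n1.
pose I := (triv V0 * 'I_n.+1)%type.
pose U (i : I) := [set L : P | frame_dom i.1 (hcoord L) 0] `&`
  [set L | hcoord L 0 i.2 != 0].
pose eta (i : I) (L : P) := coframe2 i.1 (hcoord L) 0 *m h i.1 i.2 L.
pose psi (i : I) (L : P) := eta i L *m tframe i.2 (hcoord L).
have UT (i : I) (L : P) : U i L -> trivial_on V0 i.1 L /\ trivial_on T i.2 L.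
  by move=> [di xi]; split=> //; exact/tangent_onP.
have eta_trans i j L : U i L -> U j L -> eta j L = psi i L *m tcoframe j.2 (hcoord L).
  move=> Ui Uj; have [vi ai] := UT _ _ Ui; have [vj aj] := UT _ _ Uj.
  apply/esym; rewrite /psi -mulmxA -(tangent_trans Ui.2 Uj.2) /eta -mulmxA.
  apply: etrans (congr1 (mulmx (coframe2 i.1 (hcoord L) 0))
    (esym (hc i.1 j.1 i.2 j.2 L vi vj ai aj))) _.
  by rewrite central_trans; exact: (coframe2_trans_mul _ Ui.1 Uj.1).
have oU i : open_on (U i).
  apply: open_onI; first exact: open_frame_dom0.
  exact: open_on_hcoord.
have Ucov L : exists i, U i L.
  have L0 := hcoord_neq0 L; have [v dv] := frame_dom_cover 0 L0.
  by have /rV0Pn[a xa] := L0; exists (v, a).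
have hpsi i : holomorphic_on (U i) (fun L => hcoord L 0 i.2 *: psi i L).
  have h1 : holomorphic_on (U i) (fun L => hcoord L 0 i.2 ^+ 2 *: coframe2 i.1 (hcoord L) 0).
    by apply: holomorphic_onS (@holomorphic_coframe2 R n i.1 i.2) => L [].
  have h2 : holomorphic_on (U i) (h i.1 i.2).
    by apply: holomorphic_onS (hh i.1 i.2) => L; exact: UT.
  have h3 : holomorphic_on (U i) (fun _ : P => lift_mx C i.2).
    by move=> a z _ _; exact: differentiable_cst.
  have := holomorphic_on_mulmx (holomorphic_on_mulmx h1 h2) h3.
  apply: holomorphic_eq_on; first exact: oU.
  move=> L _; rewrite /psi /eta /tframe -scalemxAr scalerA -expr2.
  by rewrite -!scalemxAl.
have glue i j L : U i L -> U j L ->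
    exists g, psi i L = psi j L + g *: (hcoord L *m 1%:M).
  move=> Ui Uj; rewrite /psi (eta_trans i j L Ui Uj).
  have [k ->] := tcoframe_frame (psi i L) Uj.2.
  by exists (k 0 0); rewrite mulmx1 mx11_mul subrK.
have [c cE] := @wedge_const R n 1%:M I U (fun i => i.2) psi oU Ucov
  (fun i L UL => UL.2) hpsi glue.
have {}cE i L : U i L -> wedge (psi i L) (hcoord L) = c.
  by move=> /(cE i L); rewrite mulmx1.
have c0 : c = 0.
  apply/matrixP => k l; rewrite mxE.
  have [m /andP[mk ml]] : exists m : 'I_n.+1, (m != k) && (m != l).
    have : (0 < #|~: [set k; l]|)%N.
      rewrite cardsCs finset.setCK cards2 card_ord subn_gt0.
      by apply: leq_ltn_trans (n1 : (1 < n)%N); case: (k != l).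
    by move=> /card_gt0P[m]; rewrite !inE negb_or => ?; exists m.
  pose em : 'rV[C]_n.+1 := delta_mx 0 m.
  have em0 : em != 0 by apply/rV0Pn; exists m; rewrite mxE !eqxx oner_eq0.
  have [i Ui] := Ucov (ppoint em); rewrite -(cE i _ Ui) wedgeE.
  have [a a0 ->] := hcoord_ppoint em0.
  by rewrite !mxE /= ![_ == m]eq_sym (negPf mk) (negPf ml) !mulr0 mul0r subrr.
have [L yL] := sub1_generic n0; have [i Ui] := Ucov L.
have psi0 : psi i L *m tcoframe i.2 (hcoord L) = 0.
  have w0 : wedge (psi i L) (hcoord L) = 0 by rewrite (cE i L Ui).
  by rewrite (wedge_eq0 w0 Ui.2) -scalemxAl tcoframe_euler ?scaler0//; exact: Ui.2.
have := eta_trans i i L Ui Ui; rewrite psi0 => eta0.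
have [vi ai] := UT _ _ Ui; have hi := hu i.1 i.2 L vi ai.
have : coframe2 i.1 (hcoord L) 0 = 0.
  by rewrite -[LHS](mulmxK hi) [_ *m h _ _ _]eta0 mul0mx.
by move/eqP; apply/negP; exact: coframe2_neq0 Ui.1 yL.
Qed.

End CentralFibre.

Theorem proposition6p1 (R : realType) (rho : {posnum R}) (n : nat)
    (hn : (2 <= n)%N) :
  exists V : cocycle (prod_atlas (pspace_atlas R n) (disc_atlas rho)) n,
    [/\ is_vbundle V,
        forall t : disc_atlas rho, val t != 0 ->
          isomorphic (slice V t) (tangent (pspace_atlas R n)),
        h0_eq (twist (slice V (disc0 rho)) (- 2)) 1%N
      & ~ isomorphic (slice V (disc0 rho)) (tangent (pspace_atlas R n))].
Proof.
exists (degeneration rho n); split.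
- exact: degeneration_vbundle.
- by move=> t t0; exact: slice_tangent (ltnW hn) t0.
- exact: h0_central (ltnW hn).
- exact: central_not_tangent.
Qed.
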